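(* Let $G$ be an asymptotically CAT(0) group. Then $G$ has a finite universal space for proper actions, i.e., there exists a universal space for proper actions $\underline{E}G$ that is a finite $G$-CW complex.
   Context: Groups are discrete; (metric) spaces acted on are nonempty. A $G$-CW complex is a CW complex with a $G$-action (permuting the open cells) such that, for all open cells $e$ and all $g\in G$, if $g\cdot e\cap e\neq\emptyset$ then $g\cdot x=x$ for all $x\in e$. It is proper if all point stabilizers are finite, and finite if it is cocompact, equivalently if it has only finitely many $G$-orbits of cells. A universal space for proper actions of $G$ is a proper $G$-CW complex $\underline{E}G$ such that, for each finite subgroup $H\le G$, the $H$-fixed point set $(\underline{E}G)^H$ is contractible. Asymptotically CAT(0) spaces and groups. Let $X$ be a geodesic metric space and let $\Delta$ be a geodesic triangle in $X$ with vertices $x_1,x_2,x_3$. The comparison triangle $\overline{\Delta}$ is a geodesic triangle in $\mathbb{R}^2$ with vertices $\overline{x_1},\overline{x_2},\overline{x_3}$ such that $d(x_i,x_j)=d(\overline{x_i},\overline{x_j})$ for all $i,j\in\{1,2,3\}$. Given a point $p\in\Delta$ on the geodesic (side) from $x_i$ to $x_j$, its comparison point is the point $\overline{p}$ on the geodesic from $\overline{x_i}$ to $\overline{x_j}$ with $d(\overline{x_i},\overline{p})=d(x_i,p)$. Set $d(\Delta)=\max\{d(x_i,x_j)\mid 1\le i<j\le 3\}$. The space $X$ is asymptotically CAT(0) if there exists a function $\sigma\colon\mathbb{R}\to\mathbb{R}$ that is sublinear, i.e., $\lim_{t\to\infty}\sigma(t)/t=0$, such that for any geodesic triangle $\Delta$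 in $X$ and any points $p,q\in\Delta$ we have $d(p,q)\le d(\overline{p},\overline{q})+\sigma(d(\Delta))$. An asymptotically CAT(0) group is a group that admits a proper and cocompact action by isometries on an asymptotically CAT(0) geodesic metric space. An action of $G$ by isometries on a metric space $X$ is proper if for each $x\in X$ there is $r>0$ such that $\{g\in G\mid g\cdot B(x,r)\cap B(x,r)\neq\emptyset\}$ is finite; it is cocompact if there is a compact $K\subseteq X$ with $X=G\cdot K$. *)

(* Defs.v *)
From HB Require Import structures.
From mathcomp Require Import all_boot all_order all_algebra.
From mathcomp Require Import all_classical all_reals all_analysis.

Set Implicit Arguments.
Unset Strict Implicit.
Unset Printing Implicit Defensive.

Import Order.TTheory GRing.Theory Num.Theory.
Import numFieldNormedType.Exports.

Local Open Scope classical_set_scope.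
Local Open Scope ring_scope.

Section Euclidean.
Context {R : realType} {n : nat}.

(* The library norm on ['rV[R]_n] is the sup norm; it induces the same topology
   but not the Euclidean metric. *)
Definition euclid_norm (u : 'rV[R]_n) : R :=
  Num.sqrt (\sum_(i < n) u ord0 i ^+ 2).

Definition euclid_dist (u v : 'rV[R]_n) : R := euclid_norm (u - v).

End Euclidean.

Definition closed_disk {R : realType} (n : nat) : set 'rV[R]_n :=
  [set u | euclid_norm u <= 1].

Definition open_disk {R : realType} (n : nat) : set 'rV[R]_n :=
  [set u | euclid_norm u < 1].

Definition unit_sphere {R : realType} (n : nat) : set 'rV[R]_n :=
  [set u | euclid_norm u = 1].

Arguments closed_disk {R} n u : rename.
Arguments open_disk {R} n u : rename.
Arguments unit_sphere {R} n u : rename.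

Section Geodesics.
Context {R : realType} {T : Type}.
Variable dist : T -> T -> R.

Definition is_geodesic (x y : T) (c : R -> T) : Prop :=
  [/\ c 0 = x, c (dist x y) = y &
      {in `[0, dist x y] &, forall s t, dist (c s) (c t) = `|s - t|}].

Definition geodesic_space : Prop :=
  forall x y, exists c, is_geodesic x y c.

(* Side [i] joins vertex [i] to vertex [i + 1 mod 3]. *)
Record geodesic_triangle := GeodesicTriangle {
  vertex : 'I_3 -> T;
  side : 'I_3 -> R -> T;
  sideP : forall i, is_geodesic (vertex i) (vertex (ordS i)) (side i)
}.

Definition on_side (D : geodesic_triangle) (i : 'I_3) : set T :=
  side D i @` `[0, dist (vertex D i) (vertex D (ordS i))].

Definition triangle_size (D : geodesic_triangle) : R :=
  \big[Num.max/0]_(i < 3) \big[Num.max/0]_(j < 3 | (i < j)%N)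
    dist (vertex D i) (vertex D j).

End Geodesics.

Section AsymptoticallyCAT0.
Context {R : realType}.

Definition plane_triangle := geodesic_triangle (@euclid_dist R 2).

Definition comparison_triangle (X : metricType R)
    (D : geodesic_triangle (@mdist R X)) (D' : plane_triangle) : Prop :=
  forall i j, euclid_dist (vertex D' i) (vertex D' j) =
              mdist (vertex D i) (vertex D j).

(* A point lying on several sides, such as a vertex, has one comparison point for
   each of them, whence the index [i]. *)
Definition comparison_point (X : metricType R)
    (D : geodesic_triangle (@mdist R X)) (D' : plane_triangle)
    (i : 'I_3) (p : X) (p' : 'rV[R]_2) : Prop :=
  [/\ on_side D i p, on_side D' i p' &
      euclid_dist (vertex D' i) p' = mdist (vertex D i) p].

Definition sublinear (sigma : R -> R) : Prop :=
  sigma t / t @[t --> +oo] --> (0 : R).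

Definition asymptotically_CAT0 (X : metricType R) : Prop :=
  exists2 sigma : R -> R, sublinear sigma &
    forall (D : geodesic_triangle (@mdist R X)) (D' : plane_triangle),
      comparison_triangle D D' ->
      forall (i j : 'I_3) (p q : X) (p' q' : 'rV[R]_2),
        comparison_point D D' i p p' -> comparison_point D D' j q q' ->
        mdist p q <= euclid_dist p' q' + sigma (triangle_size D).

End AsymptoticallyCAT0.

Section Actions.
Context {G : groupType}.

Definition is_action (T : Type) (act : G -> T -> T) : Prop :=
  (forall x, act 1%g x = x) /\
  (forall g h x, act (g * h)%g x = act g (act h x)).

Definition stabilizer (T : Type) (act : G -> T -> T) (x : T) : set G :=
  [set g | act g x = x].

Definition fixed_set (T : Type) (act : G -> T -> T) (H : {pred G}) : set T :=
  [set x | {in H, forall h, act h x = x}].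

Definition cocompact_action (T : topologicalType) (act : G -> T -> T) : Prop :=
  exists2 K : set T, compact K & \bigcup_g (act g @` K) = [set: T].

Definition isometric_action (R : realType) (X : metricType R)
    (act : G -> X -> X) : Prop :=
  forall g x y, mdist (act g x) (act g y) = mdist x y.

Definition proper_action (R : realType) (X : metricType R)
    (act : G -> X -> X) : Prop :=
  forall x, exists2 r : R, 0 < r &
    finite_set [set g | (act g @` ball x r) `&` ball x r !=set0].

End Actions.

Definition asymptotically_CAT0_group (R : realType) (G : groupType) : Prop :=
  exists (X : metricType R) (act : G -> X -> X),
    [/\ [set: X] !=set0, geodesic_space (@mdist R X) & asymptotically_CAT0 X] /\
    [/\ is_action act, isometric_action act, proper_action act &
        cocompact_action act].

(* The characteristic map of a cell is a total function on ['rV_n], of which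
   only the restriction to the closed disk is meaningful. *)
Record CW_structure (R : realType) (E : topologicalType) := CWStructure {
  cell : Type;
  cell_dim : cell -> nat;
  char_map : forall a : cell, 'rV[R]_(cell_dim a) -> E
}.

Arguments char_map {R E c} a u.

Section CWComplex.
Context {R : realType} {E : topologicalType}.
Variable S : CW_structure R E.

Definition open_cell (a : cell S) : set E :=
  char_map a @` open_disk (cell_dim a).

(* The clauses are: Hausdorff; the open cells partition [E]; the characteristic
   maps are continuous on closed disks and homeomorphisms from open disks onto
   open cells; closure-finiteness (boundaries lie in finitely many cells of lower
   dimension); weak topology. *)
Definition is_CW_complex : Prop :=
  [/\ hausdorff_space E,
      trivIset [set: cell S] open_cell /\ \bigcup_a open_cell a = [set: E],
      (forall a : cell S,
        {within closed_disk (cell_dim a), continuous (char_map a)} /\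
        exists2 f : E -> 'rV[R]_(cell_dim a),
          {within open_cell a, continuous f} &
          forall u, open_disk (cell_dim a) u -> f (char_map a u) = u),
      (forall a : cell S, exists2 B : set (cell S),
        finite_set B /\ (forall b, B b -> (cell_dim b < cell_dim a)%N) &
        char_map a @` unit_sphere (cell_dim a) `<=` \bigcup_(b in B) open_cell b)
    & (forall A : set E,
        (forall a, closed (A `&` closure (open_cell a))) -> closed A)].

Definition is_GCW_complex (G : groupType) (act : G -> E -> E) : Prop :=
  [/\ is_CW_complex,
      is_action act /\ (forall g, continuous (act g)),
      (forall g a, exists b, act g @` open_cell a = open_cell b)
    & (forall g a, (act g @` open_cell a) `&` open_cell a !=set0 ->
        forall x, open_cell a x -> act g x = x)].

(* Cocompactness of a G-CW complex amounts to having finitely many orbits of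
   cells. *)
Definition finite_GCW_complex (G : groupType) (act : G -> E -> E) : Prop :=
  is_GCW_complex act /\ cocompact_action act.

End CWComplex.

(* [E] carries the ambient topology and [A] the subspace one; a contractible set
   is in particular nonempty. *)
Definition contractible (R : realType) (E : topologicalType) (A : set E) : Prop :=
  exists (x0 : E) (h : R * E -> E),
    [/\ A x0,
        {within `[0, 1]%classic `*` A, continuous h},
        (forall t x, t \in `[0, 1] -> A x -> A (h (t, x)))
      & (forall x, A x -> h (0, x) = x /\ h (1, x) = x0)].

Definition universal_proper_space (R : realType) (G : groupType)
    (E : topologicalType) (S : CW_structure R E) (act : G -> E -> E) : Prop :=
  [/\ is_GCW_complex S act,
      (forall x, finite_set (stabilizer act x))
    & (forall H : {pred G}, group_closed H -> finite_set [set` H] ->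
        contractible R (fixed_set act H))].

(* Main.v *)
Require Import Defs.
From HB Require Import structures.
From mathcomp Require Import all_boot all_order all_algebra.
From mathcomp Require Import all_classical all_reals all_analysis.
From mathcomp Require Import finmap ring lra.

(** The universal space is a Rips complex of the group. Through an orbit map the
    distance of the asymptotically CAT(0) space becomes a left-invariant
    pseudo-metric [d] on [G] with finite balls, and [rips d r] is the space of
    probability measures on [G] whose support is finite of diameter at most [r].
    The group acts freely on itself, so it acts on this locally finite complex
    with finite stabilizers, and the complex is cocompact because the balls are
    finite. The only serious point is that the fixed-point set of every finite
    subgroup [H] is contractible when [r] is large.

    All measures with finite support, without bound on the diameter, form a
    convex set; so do the [H]-invariant ones, among which is the uniform measure
    on [H]. Hence it is enough to retract all finitely supported measures onto
    [rips d r], equivariantly and continuously on every finite simplex: the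
    straight line to the uniform measure on [H], followed by the retraction,
    contracts the fixed-point set ([fixed_set_contractible]).

    The retraction iterates a map that multiplies large diameters by [9/10]. By
    the layer-cake formula ([layer_cake]) a function on a finite set is a
    combination, with nonnegative coefficients depending continuously on it, of
    the indicators of its superlevel sets, which form a chain. Replace each
    superlevel set [s] by [C s], where [C s = s] if the diameter of [s] is at most
    [r], and [C s] is the set of all circumcentres of [s] in [G] otherwise.
    Measures in [rips d r] do not move. For the others, what matters is that
    points of the sets [C s], for [s] in a chain of subsets of a set of diameter at
    most [R], have mutual distances at most [max r (9/10 R)] ([recenter_shrinks],
    where [C] is called [recenter]). In a CAT(0) space this is Jung's theorem
    together with the inequality [d(c, c')^2 <= rad(t)^2 - rad(s)^2] for the
    centres [c] of [s] and [c'] of a set [t] containing [s]. Both follow by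
    comparing a circumcentre with a point a little further along a geodesic; a
    quarter of the geodesic gives constants that leave room for error terms. The
    triangles involved have size comparable to the scale [R] of the set, so in an
    asymptotically CAT(0) space the error is an arbitrarily small multiple of [R]
    as soon as [R] is large; this fixes [r].

    For the cell structure, barycentric subdivision is needed to make the action
    rigid. Its open simplices are the sets of measures that order the points of
    their support in the same way, with the same ties. Such an order is encoded by
    a ranking [l : G -> nat] with finite support and no gaps, and the ratios of
    consecutive values identify the open cell with an open cube; on the closed
    cube the same formula still makes sense, and faces go to cells with fewer
    levels. *)

Set Implicit Arguments.
Unset Strict Implicit.
Unset Printing Implicit Defensive.

Import Order.TTheory GRing.Theory Num.Theory.
Import numFieldNormedType.Exports.

Local Open Scope classical_set_scope.
Local Open Scope ring_scope.

(** * Comparison triangles and quarter points *)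

Section Plane.
Context {R : realType}.

Lemma euclid_normZ n (a : R) (u : 'rV[R]_n) :
  euclid_norm (a *: u) = `|a| * euclid_norm u.
Proof.
rewrite /euclid_norm -sqrtr_sqr -sqrtrM ?sqr_ge0// mulr_sumr.
by congr Num.sqrt; apply: eq_bigr => i _; rewrite mxE exprMn.
Qed.

Lemma euclid_norm_eq0 n (u : 'rV[R]_n) : euclid_norm u = 0 -> u = 0.
Proof.
move/eqP; rewrite sqrtr_eq0 => u0.
have /psumr_eq0P u2 : \sum_(i < n) u ord0 i ^+ 2 = 0.
  by apply/eqP; rewrite eq_le u0 sumr_ge0// => i _; exact: sqr_ge0.
apply/rowP => i; rewrite mxE; apply/eqP.
by rewrite -sqrf_eq0 u2// => j _; exact: sqr_ge0.
Qed.

Definition plane_seg (x y : 'rV[R]_2) (t : R) : 'rV[R]_2 :=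
  x + (t / euclid_dist x y) *: (y - x).

Lemma euclid_distC n (x y : 'rV[R]_n) : euclid_dist x y = euclid_dist y x.
Proof. by rewrite /euclid_dist -opprB -scaleN1r euclid_normZ normrN1 mul1r. Qed.

Lemma euclid_dist_ge0 n (x y : 'rV[R]_n) : 0 <= euclid_dist x y.
Proof. exact: sqrtr_ge0. Qed.

Lemma plane_seg_geodesic (x y : 'rV[R]_2) :
  is_geodesic (@euclid_dist R 2) x y (plane_seg x y).
Proof.
have D0 := euclid_dist_ge0 x y.
have [D|D] := eqVneq (euclid_dist x y) 0.
  have xy : x = y by apply/eqP; rewrite -subr_eq0; apply/eqP/euclid_norm_eq0.
  split; rewrite /plane_seg D ?invr0 ?mulr0 ?scale0r ?addr0//.
  move=> s t; rewrite !in_itv/= => s0 t0.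
  have -> : s = 0 by lra.
  have -> : t = 0 by lra.
  by rewrite subrr normr0 -[RHS]D -xy /euclid_dist !subrr.
split; first by rewrite /plane_seg mul0r scale0r addr0.
  by rewrite /plane_seg divff// scale1r addrC subrK.
move=> s t _ _; rewrite {1}/euclid_dist /plane_seg opprD addrACA subrr add0r.
rewrite -scalerBl euclid_normZ -mulrBl normrM normfV (ger0_norm D0) mulrAC -mulrA.
by rewrite -[euclid_norm _]/(euclid_dist y x) euclid_distC divff ?mulr1.
Qed.

Definition plane_point (a b : R) : 'rV[R]_2 :=
  \row_(i < 2) (if i == ord0 then a else b).

Lemma plane_dist a b c e : euclid_dist (plane_point a b) (plane_point c e) =
  Num.sqrt ((a - c) ^+ 2 + (b - e) ^+ 2).
Proof.
by rewrite /euclid_dist /euclid_norm !big_ord_recl big_ord0 !mxE/= addr0.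
Qed.

(** The law of cosines gives the first coordinate of the apex of a triangle with
    base from the origin to [(A, 0)]; the triangle inequalities are what makes the
    second one real. *)
Lemma planar_apex (A B C : R) : 0 < A -> 0 <= B -> 0 <= C ->
  A <= B + C -> B <= A + C -> C <= A + B ->
  exists p q : R, p ^+ 2 + q ^+ 2 = C ^+ 2 /\ (A - p) ^+ 2 + q ^+ 2 = B ^+ 2.
Proof.
move=> A0 B0 C0 tA tB tC.
pose p := (A ^+ 2 + C ^+ 2 - B ^+ 2) / (2 * A).
have pE : p * (2 * A) = A ^+ 2 + C ^+ 2 - B ^+ 2 by rewrite /p divfK//; lra.
have pC : p <= C by rewrite ler_pdivrMr; [nra|lra].
have Cp : - C <= p by rewrite ler_pdivlMr; [nra|lra].
have q0 : 0 <= C ^+ 2 - p ^+ 2 by nra.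
by exists p, (Num.sqrt (C ^+ 2 - p ^+ 2)); split; rewrite sqr_sqrtr//; lra.
Qed.

End Plane.

Section QuarterPoint.
Context {R : realType} {X : metricType R}.
Local Notation d := (@mdist R X).

Lemma sqrt_le_of_sqr (a b : R) : 0 <= b -> a <= b ^+ 2 -> Num.sqrt a <= b.
Proof. by move=> b0 ab; rewrite -(ger0_norm b0) -sqrtr_sqr ler_wsqrtr. Qed.

(** Stewart's theorem in the plane, transported by a comparison triangle. The
    point [c (d x y / 4)] depends only on the geodesic from [x] to [y], so that one
    choice of it serves for all [z]. *)
Lemma quarter_point_comparison (sigma : R -> R) (x y z : X) (c : R -> X) :
  geodesic_space d ->
  (forall (D : geodesic_triangle d) (D' : plane_triangle),
      comparison_triangle D D' ->
      forall (i j : 'I_3) (p q : X) (p' q' : 'rV[R]_2),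
        comparison_point D D' i p p' -> comparison_point D D' j q q' ->
        d p q <= euclid_dist p' q' + sigma (triangle_size D)) ->
  is_geodesic d x y c -> 0 < d x y ->
  d z (c (d x y / 4)) <=
    Num.sqrt (3 / 4 * d z x ^+ 2 + 1 / 4 * d z y ^+ 2 - 3 / 16 * d x y ^+ 2)
    + sigma (Num.max (Num.max (d x y) (d x z)) (d y z)).
Proof.
move=> geo cat cg A0.
have [c1 c1g] := geo y z; have [c2 c2g] := geo z x.
have [||||||p [q [pqC pqB]]] := @planar_apex R (d x y) (d y z) (d z x) => //.
- exact: mdist_ge0.
- exact: mdist_ge0.
- by rewrite (metric_sym x y) metric_triangle// (metric_sym y x) addrC
     (metric_sym z x) (metric_sym y z) metric_triangle.
- by rewrite (metric_sym x y) (metric_sym z x) metric_triangle.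
- by rewrite (metric_sym x y) addrC (metric_sym y z) metric_triangle.
set A := d x y in A0 pqC pqB *.
pose v (i : 'I_3) : X := nth x [:: x; y; z] i.
pose s (i : 'I_3) : R -> X := nth c [:: c; c1; c2] i.
have sP i : is_geodesic d (v i) (v (ordS i)) (s i).
  by case: i => [[|[|[|]]]]//=.
pose D := GeodesicTriangle sP.
pose v' (i : 'I_3) : 'rV[R]_2 :=
  nth 0 [:: plane_point 0 0; plane_point A 0; plane_point p q] i.
pose D' := GeodesicTriangle (fun i => plane_seg_geodesic (v' i) (v' (ordS i))).
have v01 : euclid_dist (plane_point 0 0) (plane_point A 0) = A.
  by rewrite plane_dist subrr sub0r sqrrN expr0n addr0 sqrtr_sqr gtr0_norm.
have v02 : euclid_dist (plane_point 0 0) (plane_point p q) = d z x.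
  by rewrite plane_dist !sub0r !sqrrN pqC sqrtr_sqr ger0_norm// mdist_ge0.
have v12 : euclid_dist (plane_point A 0) (plane_point p q) = d y z.
  by rewrite plane_dist sub0r sqrrN pqB sqrtr_sqr ger0_norm// mdist_ge0.
have v'0 (w : 'rV[R]_2) : euclid_dist w w = 0.
  by rewrite /euclid_dist subrr /euclid_norm big1 ?sqrtr0// => i _; rewrite mxE expr0n.
have cmp : comparison_triangle D D'.
  case=> [[|[|[|i]]] i3]//= [[|[|[|j]]] j3]//=; rewrite /v' /v/= ?v'0 ?mdistxx//.
  - by rewrite v02 metric_sym.
  - by rewrite euclid_distC v01 metric_sym.
  - by rewrite euclid_distC v02.
  - by rewrite euclid_distC v12 metric_sym.
have i0 : (0 < 3)%N by []. have i2 : (2 < 3)%N by [].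
have [c0x cLy cd] := cg.
have Ain : A / 4 \in `[0, A] by rewrite in_itv/=; apply/andP; split; lra.
have A0in : 0 \in `[0, A] by rewrite in_itv/=; apply/andP; split; lra.
have pz : comparison_point D D' (Ordinal i2) z (plane_point p q).
  split.
  - exists 0 => /=; first by rewrite in_itv/= lexx mdist_ge0.
    by rewrite /s/=; case: c2g.
  - exists 0 => /=; first by rewrite in_itv/= lexx euclid_dist_ge0.
    by rewrite /plane_seg mul0r scale0r addr0.
  - by rewrite /= /v' /v/= v'0 mdistxx.
have pm : comparison_point D D' (Ordinal i0) (c (A / 4)) (plane_point (A / 4) 0).
  split.
  - by exists (A / 4).
  - exists (A / 4) => /=; first by rewrite /v'/= v01.
    rewrite /v'/= /plane_seg v01; apply/rowP => i; rewrite !mxE.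
    by case: ifP => _; field; rewrite ?gt_eqF.
  - rewrite /= /v' /v/= plane_dist subrr sub0r sqrrN expr0n addr0 sqrtr_sqr.
    by rewrite -[in RHS]c0x cd // sub0r normrN.
have := cat D D' cmp _ _ _ _ _ _ pz pm.
have -> : triangle_size D = Num.max (Num.max (d x y) (d x z)) (d y z).
  have bigE (P : pred 'I_3) (F : 'I_3 -> R) :
    \big[Num.max/0]_(j < 3 | P j) F j = \big[Num.max/0]_(j < 3) (if P j then F j else 0).
    exact: bigmax_mkcond.
  rewrite /triangle_size.
  under eq_bigr do rewrite bigE !big_ord_recl big_ord0.
  rewrite !big_ord_recl big_ord0 /= /v/= !(max_l (mdist_ge0 _ _)) !maxxx.
  rewrite (max_r (mdist_ge0 _ _)) [X in Num.max _ X]max_l ?le_max ?lexx//.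
  by rewrite (max_r (mdist_ge0 y z)) (@max_r _ _ 0)// le_max mdist_ge0.
move=> /le_trans; apply; rewrite lerD2r plane_dist subr0.
rewrite le_eqVlt; apply/orP; left; apply/eqP; congr Num.sqrt.
rewrite (metric_sym z y) -pqB -pqC; by field.
Qed.

Lemma sublinear_bound (sigma : R -> R) (e : R) : sublinear sigma -> 0 < e ->
  exists2 T : R, 0 < T & forall t : R, T <= t -> sigma t <= e * t.
Proof.
move=> /cvgrPdist_lt /(_ _)/[apply] [[M [Mr HM]]].
exists (Num.max 1 (M + 1)); first by rewrite lt_max ltr01.
move=> t; rewrite ge_max => /andP[t1 tM].
have /= := HM t ltac:(lra); rewrite sub0r normrN ltr_norml => /andP[_].
by rewrite ltr_pdivrMr; [move/ltW|lra].
Qed.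

(** At scale [r] the error is at most [e * r]. This covers triangles much smaller
    than [r], on which [sigma] is not controlled, because for them the trivial
    bound by twice the size is good enough. *)
Lemma quarter_point (e : R) :
  geodesic_space d -> asymptotically_CAT0 X -> 0 < e ->
  exists2 R0 : R, 0 < R0 & forall x y, exists m, forall z (r : R), R0 <= r ->
    d z x <= r -> d z y <= r -> d x y <= r ->
    d z m <= Num.sqrt (3 / 4 * d z x ^+ 2 + 1 / 4 * d z y ^+ 2
                       - 3 / 16 * d x y ^+ 2) + e * r.
Proof.
move=> geo [sigma sub cat] e0.
have [T T0 HT] := sublinear_bound sub e0.
exists (2 * T / e); first by rewrite divr_gt0//; lra.
move=> x y; have [A0|A0] := eqVneq (d x y) 0.
  exists x => z r rT zx zy xy; rewrite -(mdist_positivity _ _ A0) mdistxx.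
  rewrite expr0n mulr0 subr0 -mulrDl.
  have -> : 3 / 4 + 1 / 4 = 1 :> R by field.
  rewrite mul1r sqrtr_sqr ger0_norm ?mdist_ge0// lerDl mulr_ge0//; first lra.
  exact: le_trans (mdist_ge0 _ _) zx.
have {}A0 : 0 < d x y by rewrite lt_neqAle eq_sym A0 mdist_ge0.
have [c cg] := geo x y; exists (c (d x y / 4)) => z r rT zx zy xy.
have := quarter_point_comparison z geo cat cg A0.
set t := Num.max _ _ => H.
have tr : t <= r by rewrite !ge_max xy metric_sym zx/= metric_sym.
have [tT|tT] := leP T t.
  apply: le_trans H _; rewrite lerD2l; apply: le_trans (HT _ tT) _.
  by rewrite ler_pM2l.
have Ter : 2 * T <= e * r by rewrite [leRHS]mulrC -ler_pdivrMr.
have : d z x <= t by rewrite metric_sym !le_max lexx orbT.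
have : d x y <= t by rewrite !le_max lexx.
have := metric_triangle z x (c (d x y / 4)).
have -> : d x (c (d x y / 4)) = d x y / 4.
  have [c0x _ cd] := cg; rewrite -{1}c0x cd ?in_itv/=.
  - by rewrite sub0r normrN ger0_norm//; lra.
  - by apply/andP; split; lra.
  - by apply/andP; split; lra.
have := sqrtr_ge0 (3 / 4 * d z x ^+ 2 + 1 / 4 * d z y ^+ 2
                       - 3 / 16 * d x y ^+ 2).
set S := Num.sqrt _; move: S => S; lra.
Qed.

End QuarterPoint.

(** * From the action to a coarse geometry on the group *)

Section ProperActions.
Context {R : realType} {X : metricType R} {G : groupType}.
Variables (act : G -> X -> X).
Local Notation d := (@mdist R X).
Hypotheses (actP : is_action act) (isoP : isometric_action act).

Lemma compact_ball_cover (K : set X) (rad : X -> R) :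
  (forall x, 0 < rad x) -> compact K ->
  exists2 B : set X, finite_set B & K `<=` \bigcup_(x in B) ball x (rad x).
Proof.
move=> rad0 cK; have [->|/set0P[x0 _]] := eqVneq K set0.
  by exists set0; [exact: finite_set0|exact: sub0set].
(* A point of [K] makes [X] a pointed space. *)
pose XP : ptopologicalType :=
  HB.pack_for ptopologicalType (X : Type) (isPointed.Build X x0) (Topological.class X).
have := cK.
rewrite -[compact K]/(@compact XP K) compact_cover.
move=> /(_ X setT (fun x => (ball x (rad x))^°)) [||B _ KB].
- by move=> x _; exact: (@open_interior X).
- by move=> x _; exists x => //; exact: (nbhsx_ballx x (rad x)).
exists [set` B]; first exact: finite_fset.
by move=> x /KB[i Bi xi]; exists i => //; exact: (@interior_subset X).
Qed.

Lemma actK g x : act g^-1%g (act g x) = x.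
Proof. by have [a1 aM] := actP; rewrite -aM mulVg a1. Qed.

Lemma ballE x e (y : X) : ball x e y = (d x y < e) :> Prop.
Proof. by rewrite ballEmdist. Qed.

(** If [g] and [g0] both carry points near [x] to points near [y], then
    [g * g0^-1] moves a point near [y] to a point near [y]; hence the radius can be
    chosen from [y] alone. *)
Lemma finite_translates (y : X) : proper_action act ->
  exists2 e : R, 0 < e &
    forall x, finite_set [set g | exists u v, [/\ d x u < e, d y v < e & act g u = v]].
Proof.
move=> /(_ y)[r r0 fin]; exists (r / 3) => [|x]; first lra.
have [[g0 [u0 [v0 [xu0 yv0 guv0]]]]|none] :=
  pselect (exists g, exists u v, [/\ d x u < r / 3, d y v < r / 3 & act g u = v]).
  apply: (sub_finite_set _ (finite_image (fun s => (s * g0)%g) fin)).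
  move=> g [u [v [xu yv guv]]]; exists (g * g0^-1)%g; last by rewrite mulgVK.
  have [a1 aM] := actP.
  have uu0 : d u u0 < r / 3 + r / 3.
    by have := metric_triangle u x u0; rewrite (metric_sym u x); lra.
  exists (act g u0); split; last first.
    rewrite ballE; have := metric_triangle y v (act g u0).
    by rewrite -[d v _](_ : d u u0 = _); [lra|rewrite -guv isoP].
  exists v0; first by rewrite ballE; lra.
  by rewrite -guv0 aM actK.
apply: (sub_finite_set _ (finite_set0 G)) => g gg.
by apply: none; exists g.
Qed.

Lemma finite_near_translates (K : set X) : proper_action act -> compact K ->
  exists2 e : R, 0 < e &
    finite_set [set g | exists u v, [/\ K u, K v & d (act g u) v < e]].
Proof.
move=> prop cK.
have /choice[e eP] : forall y, exists e : R, 0 < e /\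
    forall x, finite_set [set g | exists u v, [/\ d x u < e, d y v < e & act g u = v]].
  by move=> y; have [e e0 He] := finite_translates y prop; exists e.
have e2 y : 0 < e y / 2 by have [] := eP y; lra.
have [B finB KB] := compact_ball_cover e2 cK.
pose e0 := \big[Num.min/1]_(y <- fset_set B) (e y / 2).
have e0_gt0 : 0 < e0.
  by rewrite /e0; apply: lt_bigmin => // y _; have [] := eP y; lra.
exists e0 => //.
have [C finC KC] := compact_ball_cover (fun=> e0_gt0) cK.
apply: (@sub_finite_set _ _ (\bigcup_(y in B) \bigcup_(x in C)
  [set g | exists u v, [/\ d x u < e y, d y v < e y & act g u = v]])).
  move=> g [u [v [Ku Kv guv]]].
  have [y By] := KB _ Kv; rewrite ballE => yv.
  have [x Cx] := KC _ Ku; rewrite ballE => xu.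
  have e0y : e0 <= e y / 2.
    by apply: ge_bigmin_seq => //; rewrite in_fset_set// mem_set.
  exists y => //; exists x => //; exists u, (act g u); split => //.
    by have [] := eP y; lra.
  by have := metric_triangle y v (act g u); rewrite (metric_sym v); lra.
apply: bigcup_finite => // y _; apply: bigcup_finite => // x _.
by have [_] := eP y; exact.
Qed.

(** Cut a geodesic from [act g u] to [v] into steps of length [e / 2]: each point of
    the subdivision lies in some translate of [K], and consecutive translates
    differ by one of the finitely many elements of [finite_near_translates]. *)
Lemma finite_orbit_balls (K : set X) (x0 : X) (r : R) :
  geodesic_space d -> proper_action act -> compact K ->
  \bigcup_g (act g @` K) = [set: X] -> K x0 ->
  finite_set [set g | d (act g x0) x0 <= r].
Proof.
move=> geo prop cK GK Kx0; have [e e0 fin] := finite_near_translates prop cK.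
have [a1 aM] := actP.
suff H (n : nat) : finite_set
    [set g | exists u v, [/\ K u, K v & d (act g u) v <= n%:R * (e / 2)]].
  have [n rn] : exists n : nat, r <= n%:R * (e / 2).
    exists (Num.bound (r / (e / 2))); rewrite -ler_pdivrMr; last lra.
    have [r0|r0] := leP 0 (r / (e / 2)); first exact/ltW/archi_boundP.
    exact: le_trans (ltW r0) _.
  apply: sub_finite_set (H n) => g gr; exists x0, x0; split => //.
  exact: le_trans gr rn.
elim: n => [|n IH].
  apply: sub_finite_set fin => g [u [v [Ku Kv guv]]]; exists u, v; split => //.
  by rewrite (le_lt_trans guv)// mul0r.
apply: (sub_finite_set _ (finite_image2 (fun h s => (h * s)%g) IH fin)).
move=> g [u [v [Ku Kv guv]]].
have [c [c0 cL cd]] := geo (act g u) v.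
set L := d (act g u) v in cL cd guv.
have L0 : 0 <= L := mdist_ge0 _ _.
pose t := Num.min L (e / 2).
have t0 : 0 <= t by rewrite le_min L0/=; lra.
have tL : t <= L by rewrite ge_min lexx.
have te : t <= e / 2 by rewrite ge_min lexx orbT.
have n0 : 0 <= n%:R * (e / 2) by rewrite mulr_ge0//; lra.
have tn : L - t <= n%:R * (e / 2).
  rewrite /t minEle; case: ifP => _; first by rewrite subrr.
  by rewrite -natr1 mulrDl mul1r in guv; lra.
have : [set: X] (c t) by [].
rewrite -GK => -[h _ [w Kw hw]].
exists h.
  exists w, v; split => //; rewrite hw -cL cd ?in_itv/=.
  - by rewrite distrC ger0_norm ?subr_ge0.
  - by rewrite t0 tL.
  - by rewrite L0 lexx.
exists (h^-1 * g)%g; last by rewrite mulVKg.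
exists u, w; split => //.
rewrite -(isoP h) -aM mulVKg hw -c0 cd ?in_itv/= ?L0 ?lexx ?t0 ?tL//.
by rewrite sub0r normrN ger0_norm//; lra.
Qed.

End ProperActions.

(** The coarse geometry of an asymptotically CAT(0) space, carried by the group
    through an orbit map. The last clause is the CAT(0) inequality at the
    quarter point of a geodesic, up to an error that at large scales [r] is
    a small multiple of [r ^+ 2]; the quarter point is replaced by a nearby orbit point. *)
Record coarsely_CAT0 {R : realType} {G : groupType} (d : G -> G -> R) : Prop :=
  CoarselyCAT0 {
    cc_refl : forall g, d g g = 0;
    cc_sym : forall g h, d g h = d h g;
    cc_tri : forall g h k, d g k <= d g h + d h k;
    cc_inv : forall k g h, d (k * g)%g (k * h)%g = d g h;
    cc_fin : forall r, finite_set [set g | d 1%g g <= r];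
    cc_quarter : forall e : R, 0 < e -> exists2 r0 : R, 0 < r0 &
      forall x y, exists m, forall z (r : R), r0 <= r ->
      d z x <= r -> d z y <= r -> d x y <= r ->
      d z m ^+ 2 <= 3 / 4 * d z x ^+ 2 + 1 / 4 * d z y ^+ 2
                    - 3 / 16 * d x y ^+ 2 + e * r ^+ 2 }.

Lemma coarsely_CAT0_of_group (R : realType) (G : groupType) :
  asymptotically_CAT0_group R G -> exists d : G -> G -> R, coarsely_CAT0 d.
Proof.
move=> [X [act [[[x _] geo cat] [actP isoP prop [K cK GK]]]]].
have [a1 aM] := actP.
have [x0 Kx0] : exists x0, K x0.
  by have : [set: X] x by []; rewrite -GK => -[g _ [x0 Kx0 _]]; exists x0.
have [D D0 KD] : exists2 D : R, 0 < D & forall x, K x -> mdist x0 x <= D.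
  have [B finB KB] := compact_ball_cover (fun _ : X => ltr01 : 0 < 1 :> R) cK.
  exists (\big[Num.max/0]_(y <- fset_set B) mdist x0 y + 1).
    by rewrite ltr_wpDl//; apply: bigmax_ge_id.
  move=> y /KB[z Bz]; rewrite ballE => zy.
  apply: le_trans (metric_triangle _ z _) _; apply: lerD; last exact: ltW.
  by apply: le_bigmax_seq => //; rewrite in_fset_set// mem_set.
exists (fun g h => mdist (act g x0) (act h x0)); split.
- by move=> g; rewrite mdistxx.
- by move=> g h; rewrite metric_sym.
- by move=> g h k; exact: metric_triangle.
- by move=> k g h; rewrite !aM isoP.
- move=> r; apply: sub_finite_set (finite_orbit_balls actP isoP r geo prop cK GK Kx0).
  by move=> g; rewrite /= a1 metric_sym.
(* Replacing the quarter point by an orbit point doubles the error [e1 * r];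
   squaring then adds at most [4 * e1 * r ^+ 2 + 4 * e1 ^+ 2 * r ^+ 2]. *)
move=> e e0; pose e1 := Num.min 1 (e / 8).
have e1_gt0 : 0 < e1 by rewrite lt_min ltr01/=; lra.
have e1_1 : e1 <= 1 by rewrite ge_min lexx.
have e1_e : e1 <= e / 8 by rewrite ge_min lexx orbT.
have [R0 R00 HR0] := quarter_point geo cat e1_gt0.
exists (Num.max R0 (D / e1)); first by rewrite lt_max R00.
move=> g h; have [m Hm] := HR0 (act g x0) (act h x0).
have : [set: X] m by [].
rewrite -GK => -[k _ [w Kw kw]]; exists k => f r.
rewrite ge_max => /andP[Rr Dr] fg fh gh.
have := Hm (act f x0) r Rr fg fh gh.
rewrite ler_pdivrMr// in Dr.
have : mdist (act f x0) (act k x0) <= mdist (act f x0) m + D.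
  apply: le_trans (metric_triangle _ m _) _.
  by rewrite lerD2l -kw isoP metric_sym KD.
have := metric_triangle (act g x0) (act f x0) (act h x0).
rewrite (metric_sym (act g x0) (act f x0)).
have := mdist_ge0 (act f x0) (act k x0).
have := mdist_ge0 (act f x0) (act g x0).
have := mdist_ge0 (act f x0) (act h x0).
have := mdist_ge0 (act g x0) (act h x0).
move: fg fh gh.
move: (mdist (act f x0) (act k x0)) (mdist (act f x0) m) => p q.
move: (mdist (act f x0) (act g x0)) (mdist (act f x0) (act h x0))
  (mdist (act g x0) (act h x0)) => a b c.
move=> ar br cr c0 b0 a0 p0 cab pq.
set Q := _ - 3 / 16 * c ^+ 2.
have cab2 : c ^+ 2 <= (a + b) ^+ 2 by rewrite ler_sqr// nnegrE; lra.
have Q0 : 0 <= Q by have := sqr_ge0 (3 * a - b); rewrite /Q; lra.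
have r0 : 0 <= r by lra.
have a2r : a ^+ 2 <= r ^+ 2 by rewrite ler_sqr ?nnegrE.
have b2r : b ^+ 2 <= r ^+ 2 by rewrite ler_sqr ?nnegrE.
have Qr : Q <= r ^+ 2 by have := sqr_ge0 c; rewrite /Q; lra.
have Sr : Num.sqrt Q <= r by apply: sqrt_le_of_sqr.
have S0 := sqrtr_ge0 Q; have SQ := sqr_sqrtr Q0.
move=> qS; rewrite -[X in X + _]SQ; move: (Num.sqrt Q) Sr S0 qS => S Sr S0 qS.
have pS : p <= S + 2 * e1 * r by lra.
have e1r : 0 <= e1 * r by rewrite mulr_ge0// ltW.
have : p ^+ 2 <= (S + 2 * e1 * r) ^+ 2 by rewrite ler_sqr ?nnegrE; lra.
have : S * (e1 * r) <= r * (e1 * r) by rewrite ler_wpM2r.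
have : (e1 * r) * (e1 * r) <= r * (e1 * r).
  by rewrite ler_wpM2r// ler_piMl.
have : e1 * r ^+ 2 <= e / 8 * r ^+ 2 by rewrite ler_wpM2r ?sqr_ge0.
nra.
Qed.

Local Open Scope fset_scope.
Local Open Scope ring_scope.

(** * Circumcentres *)

Definition translate {G : groupType} (g : G) (s : {fset G}) : {fset G} :=
  [fset (g * x)%g | x in s].

Lemma mem_translate {G : groupType} (g x : G) (s : {fset G}) :
  (x \in translate g s) = ((g^-1 * x)%g \in s).
Proof.
apply/imfsetP/idP => [[y ys ->]|xs]; first by rewrite mulKg.
by exists (g^-1 * x)%g => //; rewrite mulVKg.
Qed.

Definition bounded_by {R : realType} {G : groupType} (d : G -> G -> R) (r : R)
  (s : {fset G}) : Prop := {in s &, forall x y, d x y <= r}.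

Lemma seq_argmin {R : realType} {T : eqType} (f : T -> R) (s : seq T) (x0 : T) :
  x0 \in s -> exists2 x, x \in s & {in s, forall y, f x <= f y}.
Proof.
elim: s x0 => //= y s IH x0 _.
have [->|[z zs]] : s = [::] \/ exists z, z \in s.
- by case: s IH => [|z s] IH; [left|right; exists z; rewrite inE eqxx].
- by exists y; rewrite ?inE// => w; rewrite inE => /eqP ->.
have [x xs fx] := IH z zs.
have [fyx|fxy] := leP (f y) (f x).
- exists y => [|w]; rewrite ?inE ?eqxx// => /predU1P[->//|ws].
  by rewrite (le_trans fyx)// fx.
- exists x => [|w]; rewrite ?inE ?xs ?orbT// => /predU1P[->|ws]; first exact: ltW.
  exact: fx.
Qed.

Lemma in_fset_setP {T : choiceType} (A : set T) x : finite_set A ->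
  x \in fset_set A <-> A x.
Proof. by move=> finA; rewrite in_fset_set//; split=> [/set_mem|/mem_set]. Qed.

Section Circumcenters.
Context {R : realType} {G : groupType} {d : G -> G -> R}.
Hypothesis dP : coarsely_CAT0 d.

Lemma cc_ge0 g h : 0 <= d g h.
Proof. by have := cc_tri dP g h g; rewrite (cc_refl dP) (cc_sym dP h g); lra. Qed.

Lemma cc_ball_finite g r : finite_set [set h | d g h <= r].
Proof.
apply: (sub_finite_set _ (finite_image (fun h => (g * h)%g) (cc_fin dP r))).
move=> h gh; exists (g^-1 * h)%g; last by rewrite mulVKg.
by rewrite /= -(cc_inv dP g) mulg1 mulVKg.
Qed.

Definition ecc (s : {fset G}) (g : G) : R := \big[Num.max/0]_(z <- s) d g z.

Lemma dist_le_ecc (s : {fset G}) g z : z \in s -> d g z <= ecc s g.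
Proof. by move=> zs; apply: le_bigmax_seq. Qed.

Lemma ecc_le (s : {fset G}) g r : 0 <= r -> {in s, forall z, d g z <= r} -> ecc s g <= r.
Proof. by move=> r0 H; rewrite /ecc big_seq; apply: bigmax_le. Qed.

Lemma ecc_ge0 (s : {fset G}) g : 0 <= ecc s g.
Proof. exact: bigmax_ge_id. Qed.

Lemma ecc_attained (s : {fset G}) g z0 : z0 \in s ->
  exists2 z, z \in s & ecc s g = d g z.
Proof.
move=> z0s; have [z zs zmin] := @seq_argmin R G (fun z => - d g z) s z0 z0s.
exists z => //; apply/eqP; rewrite eq_le dist_le_ecc// andbT.
by apply: ecc_le => [|w ws]; [exact: cc_ge0|rewrite -lerN2 zmin].
Qed.

Definition centers (s : {fset G}) : set G := [set g | forall h, ecc s g <= ecc s h].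

Lemma centers_finite (s : {fset G}) z0 : z0 \in s -> finite_set (centers s).
Proof.
move=> z0s; apply: sub_finite_set (cc_ball_finite z0 (ecc s z0)) => g gc /=.
by rewrite (cc_sym dP) (le_trans (dist_le_ecc g z0s)).
Qed.

Lemma centers_exist (s : {fset G}) z0 : z0 \in s -> exists g, centers s g.
Proof.
move=> z0s; have fin := cc_ball_finite z0 (ecc s z0).
have z0b : z0 \in fset_set [set h | d z0 h <= ecc s z0].
  by apply/in_fset_setP => //=; rewrite (cc_refl dP) ecc_ge0.
have [g gb gmin] := seq_argmin (ecc s) z0b.
exists g => h; have [sh|sh] := leP (ecc s h) (ecc s z0).
  apply: gmin; apply/in_fset_setP => //=; rewrite (cc_sym dP).
  by rewrite (le_trans (dist_le_ecc h z0s)).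
by apply: le_trans (ltW sh); exact: gmin.
Qed.

(** Small sets are left alone, so that the retraction built from this map fixes
    the Rips complex; large ones are sent to the set of all their circumcentres,
    a choice that commutes with the action of the group. *)
Definition recenter (r : R) (s : {fset G}) : {fset G} :=
  if `[< bounded_by d r s >] then s else fset_set (centers s).

Lemma recenter_small r s : bounded_by d r s -> recenter r s = s.
Proof. by rewrite /recenter => /asboolP ->. Qed.

Lemma mem_recenter r s z0 x : z0 \in s -> ~ bounded_by d r s ->
  x \in recenter r s -> centers s x.
Proof.
move=> z0s /asboolPn/negbTE; rewrite /recenter => ->.
by move/in_fset_setP; apply; exact: centers_finite z0s.
Qed.

Lemma recenter_nonempty r s z0 : z0 \in s -> exists x, x \in recenter r s.
Proof.
move=> z0s; rewrite /recenter; case: ifP => _; first by exists z0.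
have [g gs] := centers_exist z0s; exists g.
by apply/in_fset_setP => //; exact: centers_finite z0s.
Qed.

Lemma bounded_translate r g s : bounded_by d r (translate g s) <-> bounded_by d r s.
Proof.
split=> H x y xs ys.
  by rewrite -(cc_inv dP g) H// mem_translate mulKg.
rewrite -(cc_inv dP g^-1); apply: H; by rewrite -mem_translate.
Qed.

Lemma ecc_translate g s h : ecc (translate g s) (g * h)%g = ecc s h.
Proof.
apply/eqP; rewrite eq_le; apply/andP; split; apply: ecc_le => [|z zs].
- exact: ecc_ge0.
- rewrite -(cc_inv dP g^-1) mulKg; apply: dist_le_ecc.
  by rewrite -mem_translate.
- exact: ecc_ge0.
- by rewrite -(cc_inv dP g); apply: dist_le_ecc; rewrite mem_translate mulKg.
Qed.

Lemma centers_translate g s h : centers (translate g s) (g * h)%g <-> centers s h.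
Proof.
split=> H k; first by rewrite -(ecc_translate g s h) -(ecc_translate g s k) H.
by rewrite ecc_translate -(mulVKg g k) ecc_translate.
Qed.

Lemma recenter_translate r g s : recenter r (translate g s) = translate g (recenter r s).
Proof.
rewrite /recenter (asbool_equiv_eq (bounded_translate r g s)).
case: ifPn => // /asboolPn nb.
have [z0 z0s] : exists z0, z0 \in s.
  have [s0|/fset0Pn//] := eqVneq s fset0.
  by exfalso; apply: nb => x y; rewrite s0 inE.
have gz0 : (g * z0)%g \in translate g s by rewrite mem_translate mulKg.
apply/fsetP => x; rewrite mem_translate -[x in LHS](mulVKg g).
apply/idP/idP => /in_fset_setP H; apply/in_fset_setP.
- exact: centers_finite z0s.
- by apply/centers_translate/H; exact: centers_finite gz0.
- exact: centers_finite gz0.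
- by apply/centers_translate/H; exact: centers_finite z0s.
Qed.

(* The value [1 / 1000] leaves a comfortable margin in the two estimates below. *)
Variable (r0 : R).
Hypothesis r0_gt0 : 0 < r0.
Hypothesis quarter : forall x y, exists m, forall z (r : R), r0 <= r ->
  d z x <= r -> d z y <= r -> d x y <= r ->
  d z m ^+ 2 <= 3 / 4 * d z x ^+ 2 + 1 / 4 * d z y ^+ 2
                - 3 / 16 * d x y ^+ 2 + 1 / 1000 * r ^+ 2.

Lemma centers_ecc_le (s : {fset G}) (r : R) z0 x : z0 \in s -> 0 <= r ->
  bounded_by d r s -> centers s x -> ecc s x <= r.
Proof.
move=> z0s rr sr xs; apply: le_trans (xs z0) _.
by apply: ecc_le => // z zs; apply: sr.
Qed.

Lemma ecc_sq_le_quarter (s : {fset G}) m B z0 : z0 \in s ->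
  {in s, forall z, d z m ^+ 2 <= B} -> ecc s m ^+ 2 <= B.
Proof.
move=> z0s H; have [z zs ->] := ecc_attained m z0s.
by rewrite (cc_sym dP) H.
Qed.

Lemma sqr_le_mono (a b : R) : 0 <= a -> a <= b -> a ^+ 2 <= b ^+ 2.
Proof. by move=> a0 ab; rewrite ler_sqr ?nnegrE// (le_trans a0). Qed.

Lemma le_of_sqr (a b : R) : 0 <= b -> a ^+ 2 <= b ^+ 2 -> a <= b.
Proof.
move=> b0 ab; have [a0|/ltW a0] := leP 0 a; last exact: le_trans b0.
by rewrite -ler_sqr ?nnegrE.
Qed.

(** Jung's theorem: moving a circumcentre a quarter of the way towards a
    farthest point of the set cannot decrease the circumradius. *)
Lemma jung (s : {fset G}) (r : R) z0 x : z0 \in s -> r0 <= r ->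
  bounded_by d r s -> centers s x -> ecc s x ^+ 2 <= 58 / 100 * r ^+ 2.
Proof.
move=> z0s r0r sr xs; have rr : 0 <= r by exact: le_trans (ltW r0_gt0) r0r.
have er := centers_ecc_le z0s rr sr xs.
have [w ws ew] := ecc_attained x z0s.
have [m Hm] := quarter x w.
have : ecc s m ^+ 2 <= 9 / 16 * ecc s x ^+ 2 + (1 / 4 + 1 / 1000) * r ^+ 2.
  apply: (ecc_sq_le_quarter z0s) => z zs.
  have zx : d z x <= ecc s x by rewrite (cc_sym dP) dist_le_ecc.
  have := Hm z r r0r (le_trans zx er) (sr _ _ zs ws) ltac:(by rewrite -ew).
  rewrite -ew; have := sqr_le_mono (cc_ge0 _ _) zx.
  by have := sqr_le_mono (cc_ge0 _ _) (sr _ _ zs ws); lra.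
have := sqr_le_mono (ecc_ge0 _ _) (xs m); have := sqr_ge0 r; lra.
Qed.

(** Moving [x] a quarter of the way towards [y] cannot decrease the circumradius of
    [s], which gives
    [3/4 * d x y ^+ 2 <= ecc t y ^+ 2 - ecc s x ^+ 2] up to the error. With Jung's
    constant [4/7] this yields [16/21 < (9/10) ^ 2]; the midpoint in both steps
    would yield [4/3]. *)
Lemma centers_close (s t : {fset G}) (r : R) z0 x y : z0 \in s -> s `<=` t ->
  r0 <= r -> bounded_by d r t -> centers s x -> centers t y ->
  d x y <= 9 / 10 * r.
Proof.
move=> z0s st r0r tr xs yt; have rr : 0 <= r by exact: le_trans (ltW r0_gt0) r0r.
have sr : bounded_by d r s.
  by move=> u v us vs; apply: tr; exact: (fsubsetP st).
have z0t : z0 \in t by exact: (fsubsetP st).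
have exr := centers_ecc_le z0s rr sr xs; have eyr := centers_ecc_le z0t rr tr yt.
have dz z : z \in s -> d z x <= ecc s x /\ d z y <= ecc t y.
  move=> zs; rewrite !(cc_sym dP z) !dist_le_ecc//.
  exact: (fsubsetP st).
have xy2 : d x y <= 2 * r.
  have [? ?] := dz _ z0s; have := cc_tri dP x z0 y; rewrite (cc_sym dP x z0); lra.
have [m Hm] := quarter x y.
have : ecc s m ^+ 2 <= 3 / 4 * ecc s x ^+ 2 + 1 / 4 * ecc t y ^+ 2
    - 3 / 16 * d x y ^+ 2 + 4 / 1000 * r ^+ 2.
  apply: (ecc_sq_le_quarter z0s) => z zs; have [zx zy] := dz z zs.
  have := Hm z (2 * r) ltac:(lra) ltac:(lra) ltac:(lra) xy2.
  have := sqr_le_mono (cc_ge0 _ _) zx; have := sqr_le_mono (cc_ge0 _ _) zy.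
  rewrite [(2 * r) ^+ 2]exprMn; lra.
have := sqr_le_mono (ecc_ge0 _ _) (xs m).
have := jung z0t r0r tr yt => J1 J2 J3.
have : d x y ^+ 2 <= (9 / 10 * r) ^+ 2.
  have := sqr_ge0 (ecc s x); have := sqr_ge0 r; rewrite exprMn; lra.
by apply: le_of_sqr; lra.
Qed.

(** When [s] is small and [t] is not, the bound is the circumradius of [t], because
    [recenter r0 s = s] is contained in [t]. *)
Lemma recenter_shrinks (s t : {fset G}) (r : R) x y : s `<=` t ->
  bounded_by d r t -> x \in recenter r0 s -> y \in recenter r0 t ->
  d x y <= Num.max r0 (9 / 10 * r).
Proof.
move=> st tr xs yt; rewrite le_max.
have sub u : u \in s -> u \in t by move=> us; exact: (fsubsetP st).
have [tb|tb] := pselect (bounded_by d r0 t).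
  have sb : bounded_by d r0 s by move=> u v us vs; apply: tb; exact: sub.
  rewrite recenter_small // in xs; rewrite recenter_small // in yt.
  by rewrite (tb _ _ (sub _ xs) yt).
have r0r : r0 <= r.
  rewrite leNgt; apply/negP => rr0; apply: tb => u v ut vt.
  exact: le_trans (tr _ _ ut vt) (ltW rr0).
have [sb|sb] := pselect (bounded_by d r0 s).
  rewrite recenter_small// in xs; have {}yt := mem_recenter (sub _ xs) tb yt.
  have := jung (sub _ xs) r0r tr yt.
  have := sqr_le_mono (cc_ge0 _ _) (dist_le_ecc y (sub _ xs)) => H1 H2.
  have : d y x ^+ 2 <= (9 / 10 * r) ^+ 2.
    by have := sqr_ge0 r; rewrite exprMn; lra.
  have rr : 0 <= r by exact: le_trans (ltW r0_gt0) r0r.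
  by rewrite (cc_sym dP x) => /le_of_sqr ->; [rewrite orbT|lra].
have [z0 z0s] : exists z0, z0 \in s.
  have [s0|/fset0Pn//] := eqVneq s fset0.
  by exfalso; apply: sb => u v; rewrite s0 inE.
have {}xs := mem_recenter z0s sb xs.
have {}yt := mem_recenter (sub _ z0s) tb yt.
by rewrite (centers_close z0s st r0r tr xs yt) orbT.
Qed.

End Circumcenters.

(** All that the rest of the argument needs to know about the geometry. *)
Record proper_metric {R : realType} {G : groupType} (d : G -> G -> R) : Prop :=
  ProperMetric {
    pm_refl : forall g, d g g = 0;
    pm_sym : forall g h, d g h = d h g;
    pm_inv : forall k g h, d (k * g)%g (k * h)%g = d g h;
    pm_fin : forall g s, finite_set [set h | d g h <= s] }.

Record recentering {R : realType} {G : groupType} (d : G -> G -> R) (r0 : R)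
    (C : {fset G} -> {fset G}) : Prop := Recentering {
  rc_gt0 : 0 < r0;
  rc_small : forall s, bounded_by d r0 s -> C s = s;
  rc_nonempty : forall s, s != fset0 -> C s != fset0;
  rc_equiv : forall g s, C (translate g s) = translate g (C s);
  rc_shrink : forall s t r x y, s `<=` t -> bounded_by d r t ->
    x \in C s -> y \in C t -> d x y <= Num.max r0 (9 / 10 * r) }.

Lemma coarsely_CAT0_proper (R : realType) (G : groupType) (d : G -> G -> R) :
  coarsely_CAT0 d -> proper_metric d.
Proof.
move=> dP; split; [exact: cc_refl|exact: cc_sym|exact: cc_inv|exact: cc_ball_finite].
Qed.

Lemma coarsely_CAT0_recentering (R : realType) (G : groupType) (d : G -> G -> R) :
  coarsely_CAT0 d -> exists r0 C, recentering d r0 C.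
Proof.
move=> dP; have e0 : 0 < 1 / 1000 :> R by lra.
have [r0 r00 quarter] := cc_quarter dP e0.
exists r0, (recenter (d := d) r0); split => //.
- exact: recenter_small.
- move=> s /fset0Pn[z0 z0s]; apply/fset0Pn; exact: recenter_nonempty z0s.
- exact: recenter_translate.
- exact: recenter_shrinks.
Qed.

(** * Layers of a function *)

Section Gaps.
Context {R : realType} {G : choiceType}.
Implicit Types (F s : {fset G}) (f : G -> R).

(** The length of the interval of levels [t > m] whose superlevel set
    [{v in F | t <= f v}] is exactly [s]; in this form it is visibly continuous in
    [f]. [B] stands for the minimum over the empty set. *)
Definition layer (B m : R) F f s : R :=
  Num.max 0 (\big[Num.min/B]_(v <- s) f v - \big[Num.max/m]_(w <- F `\` s) f w).

Lemma layer_ge0 B m F f s : 0 <= layer B m F f s.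
Proof. by rewrite le_max lexx. Qed.

Lemma layer_gt0 B m F f s : 0 < layer B m F f s ->
  forall a, a \in s -> m < f a /\ forall b, b \in F -> b \notin s -> f b < f a.
Proof.
rewrite lt_max ltxx/= subr_gt0 => lt a sa.
have {}lt : \big[Num.max/m]_(w <- F `\` s) f w < f a.
  by apply: lt_le_trans lt _; exact: ge_bigmin_seq.
split=> [|b Fb sb]; first by apply: le_lt_trans lt; exact: bigmax_ge_id.
by apply: le_lt_trans lt; apply: le_bigmax_seq => //; rewrite inE sb.
Qed.

(** A point of [s] outside [t] and a point of [t] outside [s] would each have the
    larger value. *)
Lemma layer_chain B m F f s t : s `<=` F -> t `<=` F ->
  0 < layer B m F f s -> 0 < layer B m F f t -> s `<=` t \/ t `<=` s.
Proof.
move=> /fsubsetP sF /fsubsetP tF gs gt.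
have [st|/fsubsetPn[a sa ta]] := boolP (s `<=` t); first by left.
have [ts|/fsubsetPn[b tb sb]] := boolP (t `<=` s); first by right.
have [_ /(_ b (tF _ tb) sb) ba] := layer_gt0 gs sa.
have [_ /(_ a (sF _ sa) ta)] := layer_gt0 gt tb.
by rewrite ltNge (ltW ba).
Qed.

Lemma big_fpowerset_notin (u : G) F (P : pred {fset G}) (H : {fset G} -> R) :
  \sum_(s <- fpowerset F | P s && (u \notin s)) H s =
  \sum_(s <- fpowerset (F `\ u) | P s) H s.
Proof.
rewrite -big_filter -[RHS]big_filter; apply: perm_big; apply: uniq_perm.
- exact/filter_uniq/fset_uniq.
- exact/filter_uniq/fset_uniq.
- by move=> s; rewrite !mem_filter !fpowersetE fsubsetD1 -andbA [_ && (s `<=` F)]andbC.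
Qed.

(** By induction, removing from [F] a point [u] where [f] is least: [F] is the only
    superlevel set containing [u], and for the others [u] only raises the bottom
    level [m] to [f u]. *)
Lemma layer_cake B m F f v : {in F, forall w, f w <= B} -> v \in F ->
  \sum_(s <- fpowerset F | v \in s) layer B m F f s = Num.max 0 (f v - m).
Proof.
have [n] := ubnP #|` F|; elim: n m F => // n IH m F nF FB vF.
have [u uF fu] := seq_argmin f vF.
have uniqP := fset_uniq (fpowerset F).
rewrite (bigID (fun s => u \notin s))/= big_fpowerset_notin.
have -> : \sum_(s <- fpowerset F | (v \in s) && ~~ (u \notin s)) layer B m F f s =
    Num.max 0 (f u - m).
  rewrite -big_filter (bigD1_seq F) ?filter_uniq//=; last first.
    by rewrite mem_filter vF uF fpowersetE fsubset_refl.
  rewrite big_seq_cond big1 ?addr0 => [|s]; last first.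
    rewrite mem_filter fpowersetE negbK => /andP[/andP[/andP[_ us] sF] sneF].
    apply/eqP; rewrite eq_le layer_ge0 andbT leNgt; apply/negP => /layer_gt0/(_ u us)[_].
    have /fsubsetPn[w wF ws] : ~~ (F `<=` s).
      by apply: contra sneF => Fs; rewrite eqEfsubset sF.
    by move=> /(_ w wF ws); rewrite ltNge fu.
  rewrite /layer fsetDv [X in _ - X]big_seq [X in _ - X]big_pred0; last first.
    by move=> w; rewrite inE.
  congr (Num.max 0 (_ - m)).
  apply/eqP; rewrite eq_le; apply/andP; split; first exact: ge_bigmin_seq.
  by rewrite big_seq; apply: le_bigmin => [|w]; [exact: FB|exact: fu].
have layerE s : s \in fpowerset (F `\ u) ->
    layer B m F f s = layer B (Num.max m (f u)) (F `\ u) f s.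
  rewrite fpowersetE fsubsetD1 => /andP[/fsubsetP sF us].
  rewrite /layer; congr (Num.max 0 (_ - _)); apply/eqP; rewrite eq_le; apply/andP; split.
    rewrite big_seq; apply: bigmax_le => [|w].
      by apply: le_trans (bigmax_ge_id _ _ _ _); rewrite le_max lexx.
    rewrite in_fsetD => /andP[ws wF]; have [->|wu] := eqVneq w u.
      by apply: le_trans (bigmax_ge_id _ _ _ _); rewrite le_max lexx orbT.
    by apply: le_bigmax_seq => //; rewrite !inE ws wu.
  rewrite big_seq; apply: bigmax_le => [|w].
    by rewrite ge_max bigmax_ge_id/=; apply: le_bigmax_seq => //; rewrite !inE us.
  rewrite !inE => /andP[ws /andP[wu wF]].
  by apply: le_bigmax_seq => //; rewrite !inE ws.
have [vu|vu] := eqVneq v u.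
  rewrite big_seq_cond big1 ?add0r ?vu// => s; rewrite fpowersetE fsubsetD1.
  by move=> /andP[/andP[_ /negbTE->]].
rewrite big_seq_cond; under eq_bigr => s /andP[sF _] do rewrite layerE//.
rewrite -big_seq_cond IH ?inE ?vu//.
- have := fu _ vF; rewrite !maxElt; do !case: ifPn; rewrite -?leNgt; lra.
- by move: nF; rewrite (cardfsD1 u) uF.
- by move=> w /fsetD1P[_]; exact: FB.
Qed.

Definition height F f : R := \big[Num.max/0]_(w <- F) f w.

Lemma height_sub F F' f : F `<=` F' -> {in F', forall v, v \notin F -> f v = 0} ->
  height F' f = height F f.
Proof.
move=> /fsubsetP FF' f0; apply/eqP; rewrite eq_le; apply/andP; split;
  rewrite /height big_seq; apply: bigmax_le => [|v vF]; rewrite ?bigmax_ge_id//.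
  have [/le_bigmax_seq->//|/f0->//] := boolP (v \in F).
  exact: bigmax_ge_id.
by apply: le_bigmax_seq => //; exact: FF'.
Qed.

Definition weight F f s : R := layer (height F f) 0 F f s.

(** Thus the weights of a finitely supported function may be computed in any finite
    set containing its support, in particular in one that serves for all nearby
    functions. *)
Lemma weight_sub F F' f s : F `<=` F' -> {in F', forall v, v \notin F -> f v = 0} ->
  s `<=` F -> weight F' f s = weight F f s.
Proof.
move=> FF' f0 sF; rewrite /weight (height_sub FF' f0) /layer; congr (Num.max 0 (_ - _)).
apply: height_sub; first exact: fsetSD.
by move=> v; rewrite !inE => /andP[-> /f0].
Qed.

Lemma weight_zero F f s a : a \in s -> f a = 0 -> weight F f s = 0.
Proof.
move=> sa fa; apply/eqP; rewrite eq_le layer_ge0 andbT leNgt; apply/negP.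
by move=> /layer_gt0/(_ a sa)[]; rewrite fa ltxx.
Qed.

Lemma cvg_max {T : Type} (FF : set_system T) {_ : Filter FF} (f g : T -> R) (a b : R) :
  f x @[x --> FF] --> a -> g x @[x --> FF] --> b ->
  Num.max (f x) (g x) @[x --> FF] --> Num.max a b.
Proof.
move=> fa gb; under eq_fun do rewrite maxr_absE.
rewrite maxr_absE; apply: cvgM; last exact: cvg_cst.
apply: cvgD; first exact: cvgD.
by apply: cvg_norm; exact: cvgB.
Qed.

Lemma cvg_min {T : Type} (FF : set_system T) {_ : Filter FF} (f g : T -> R) (a b : R) :
  f x @[x --> FF] --> a -> g x @[x --> FF] --> b ->
  Num.min (f x) (g x) @[x --> FF] --> Num.min a b.
Proof.
move=> fa gb; under eq_fun do rewrite minr_absE.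
rewrite minr_absE; apply: cvgM; last exact: cvg_cst.
apply: cvgB; first exact: cvgD.
by apply: cvg_norm; exact: cvgB.
Qed.

Lemma cvg_bigop {T : Type} (FF : set_system T) {_ : Filter FF} (op : R -> R -> R)
    (u0 : T -> R) (a0 : R) (I : Type) (r : seq I) (u : I -> T -> R) (a : I -> R) :
  (forall (f g : T -> R) b c, f x @[x --> FF] --> b -> g x @[x --> FF] --> c ->
    op (f x) (g x) @[x --> FF] --> op b c) ->
  u0 x @[x --> FF] --> a0 -> (forall i, u i x @[x --> FF] --> a i) ->
  \big[op/u0 x]_(i <- r) u i x @[x --> FF] --> \big[op/a0]_(i <- r) a i.
Proof.
move=> opc u0a ua; elim: r => [|i r IH].
  by under eq_fun do rewrite big_nil; rewrite big_nil.
by under eq_fun do rewrite big_cons; rewrite big_cons; apply: opc.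
Qed.

Lemma cvg_weight {T : Type} (FF : set_system T) {_ : Filter FF} (phi : T -> G -> R)
    f F s : (forall v, phi x v @[x --> FF] --> f v) ->
  weight F (phi x) s @[x --> FF] --> weight F f s.
Proof.
move=> phif; rewrite /weight /layer /height.
apply: cvg_max; first exact: cvg_cst.
apply: cvgB; apply: cvg_bigop => //; try exact: cvg_min; try exact: cvg_max.
- by apply: cvg_bigop => //; [exact: cvg_max|exact: cvg_cst].
- exact: cvg_cst.
Qed.

End Gaps.

(** * Retracting measures onto small supports *)

Section Push.
Context {G : groupType} {V : eqType} {v0 : V}.
Implicit Types (f : {fsfun G -> V with v0}).

Definition push (g : G) f : {fsfun G -> V with v0} :=
  [fsfun v in translate g (finsupp f) => f (g^-1 * v)%g | v0].

Lemma pushE g f v : push g f v = f (g^-1 * v)%g.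
Proof. by rewrite fsfunE mem_translate; case: finsuppP. Qed.

Lemma finsupp_push g f : finsupp (push g f) = translate g (finsupp f).
Proof. by apply/fsetP => v; rewrite mem_translate !mem_finsupp pushE. Qed.

Lemma push1 f : push 1%g f = f.
Proof. by apply/fsfunP => v; rewrite pushE invg1 mul1g. Qed.

Lemma pushM g h f : push (g * h)%g f = push g (push h f).
Proof. by apply/fsfunP => v; rewrite !pushE invgM mulgA. Qed.

Lemma pushK g : cancel (push g) (push g^-1%g).
Proof. by move=> f; rewrite -pushM mulVg push1. Qed.

End Push.

Section Recentering.
Context {R : realType} {G : groupType}.
Variables (d : G -> G -> R) (r0 : R) (C : {fset G} -> {fset G}).
Hypotheses (dP : proper_metric d) (CP : recentering d r0 C).
Let d_sym := pm_sym dP.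
Let d_inv := pm_inv dP.
Let r0_gt0 := rc_gt0 CP.
Let C_small := rc_small CP.
Let C_nonempty := rc_nonempty CP.
Let C_equiv := rc_equiv CP.
Let C_shrink := rc_shrink CP.

Local Notation mass := {fsfun G -> R with 0}.
Implicit Types (f : mass) (F s : {fset G}).

Definition nonneg f : Prop := forall v, 0 <= f v.

Lemma finsupp_gt0 f v : nonneg f -> (v \in finsupp f) = (0 < f v).
Proof. by move=> f0; rewrite mem_finsupp lt_neqAle f0 andbT eq_sym. Qed.

Definition moved F : {fset G} := \bigcup_(s <- fpowerset F) C s.

Definition recenter_sum F (f : G -> R) (v : G) : R :=
  \sum_(s <- fpowerset F) weight F f s * (v \in C s)%:R.

(** Write [f] as a nonnegative combination of indicators of its superlevel sets,
    and replace each superlevel set [s] by [C s]. *)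
Definition recenter_mass f : mass :=
  [fsfun v in moved (finsupp f) => recenter_sum (finsupp f) f v | 0].

Lemma recenter_massE F f v : finsupp f `<=` F -> recenter_mass f v = recenter_sum F f v.
Proof.
move=> fF; have -> : recenter_sum F f v = recenter_sum (finsupp f) f v.
  rewrite /recenter_sum; symmetry.
  transitivity (\sum_(s <- fpowerset (finsupp f)) weight F f s * (v \in C s)%:R).
    rewrite big_seq [RHS]big_seq; apply: eq_bigr => s; rewrite fpowersetE => sf.
    by rewrite (weight_sub fF)// => w _; exact: fsfun_dflt.
  apply: big_fset_incl; first by rewrite fpowersetS.
  move=> s _; rewrite fpowersetE => /fsubsetPn[a sa fa].
  by rewrite (weight_zero _ sa) ?mul0r// fsfun_dflt.
rewrite fsfunE; case: ifPn => // vC; rewrite /recenter_sum big_seq big1// => s sF.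
case: (boolP (v \in C s)) => vs; rewrite ?mulr0//.
by case/negP: vC; apply/bigfcupP; exists s; rewrite ?sF.
Qed.

Lemma finsupp_recenter_mass f : finsupp (recenter_mass f) `<=` moved (finsupp f).
Proof.
apply/fsubsetP => v; rewrite mem_finsupp fsfunE; case: ifP => //.
by rewrite eqxx.
Qed.

Lemma weight_ge0 F (f : G -> R) s : 0 <= weight F f s.
Proof. exact: layer_ge0. Qed.

Lemma recenter_mass_ge0 f : nonneg (recenter_mass f).
Proof.
move=> v; rewrite (recenter_massE _ (fsubset_refl _)); apply: sumr_ge0 => s _.
by rewrite mulr_ge0 ?weight_ge0.
Qed.

Lemma layer_cake_mass f v : nonneg f ->
  \sum_(s <- fpowerset (finsupp f) | v \in s) weight (finsupp f) f s = f v.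
Proof.
move=> f0; have [vf|vf] := boolP (v \in finsupp f).
  rewrite layer_cake//; first by rewrite subr0 max_r.
  by move=> w wf; apply: le_bigmax_seq.
rewrite big_seq_cond big1 ?fsfun_dflt// => s; rewrite fpowersetE => /andP[/fsubsetP sf vs].
by rewrite sf in vf.
Qed.

Lemma mem_recenter_mass f v : v \in finsupp (recenter_mass f) ->
  exists s, [/\ s `<=` finsupp f, 0 < weight (finsupp f) f s & v \in C s].
Proof.
rewrite finsupp_gt0; last exact: recenter_mass_ge0.
rewrite (recenter_massE _ (fsubset_refl _)) /recenter_sum big_seq => H.
have [//|] := pselect (exists s, [/\ s `<=` finsupp f, 0 < weight (finsupp f) f s & v \in C s]).
move=> none; move: H; rewrite big1 ?ltxx// => s; rewrite fpowersetE => sf.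
have [vs|vs] := boolP (v \in C s); rewrite ?mulr0//.
have [ws|ws] := ltP 0 (weight (finsupp f) f s); first by case: none; exists s.
by have /eqP -> : weight (finsupp f) f s == 0; rewrite ?mul0r// eq_le ws weight_ge0.
Qed.

Lemma recenter_mass_small f : nonneg f -> bounded_by d r0 (finsupp f) -> recenter_mass f = f.
Proof.
move=> f0 fb; apply/fsfunP => v.
rewrite (recenter_massE _ (fsubset_refl _)) -[RHS]layer_cake_mass// [RHS]big_mkcond/=.
rewrite /recenter_sum big_seq [RHS]big_seq; apply: eq_bigr => s; rewrite fpowersetE.
move=> /fsubsetP sf; rewrite C_small; last by move=> x y /sf xf /sf yf; exact: fb.
by case: ifP; rewrite ?mulr1 ?mulr0.
Qed.

Lemma recenter_mass_neq0 f : nonneg f -> finsupp f != fset0 -> finsupp (recenter_mass f) != fset0.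
Proof.
move=> f0 /fset0Pn[v vf].
have : 0 < f v by rewrite -finsupp_gt0.
rewrite -layer_cake_mass// => H.
have [s [sf vs ws]] : exists s, [/\ s `<=` finsupp f, v \in s & 0 < weight (finsupp f) f s].
  apply: contrapT => none; move: H; rewrite big_seq_cond big1 ?ltxx// => s.
  rewrite fpowersetE => /andP[sf vs].
  have [ws|ws] := ltP 0 (weight (finsupp f) f s); first by case: none; exists s.
  by apply/eqP; rewrite eq_le ws weight_ge0.
have /fset0Pn[y ys] : C s != fset0 by apply: C_nonempty; apply/fset0Pn; exists v.
apply/fset0Pn; exists y; rewrite finsupp_gt0; last exact: recenter_mass_ge0.
rewrite (recenter_massE _ (fsubset_refl _)) /recenter_sum (bigD1_seq s) ?fset_uniq ?fpowersetE//=.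
rewrite ys mulr1 ltr_wpDr// sumr_ge0// => t _.
by rewrite mulr_ge0 ?weight_ge0.
Qed.

Lemma recenter_mass_shrinks f r : bounded_by d r (finsupp f) ->
  bounded_by d (Num.max r0 (9 / 10 * r)) (finsupp (recenter_mass f)).
Proof.
move=> fb x y /mem_recenter_mass[s [sf ws xs]] /mem_recenter_mass[t [tf wt yt]].
have bd u : u `<=` finsupp f -> bounded_by d r u.
  by move=> /fsubsetP uf a b /uf af /uf bf; exact: fb.
have [st|ts] := layer_chain sf tf ws wt.
  exact: (C_shrink st (bd _ tf) xs yt).
by rewrite d_sym; exact: (C_shrink ts (bd _ sf) yt xs).
Qed.

Lemma push_ge0 g f : nonneg f -> nonneg (push g f).
Proof. by move=> f0 v; rewrite pushE. Qed.

Lemma big_translate (T : Type) (idx : T) (op : SemiGroup.com_law T) g s (H : G -> T) :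
  \big[op/idx]_(v <- translate g s) H v = \big[op/idx]_(v <- s) H (g * v)%g.
Proof.
rewrite (perm_big _ (enum_imfset _ _)) ?big_map//= => x y _ _; exact: mulgI.
Qed.

Lemma translateK g s : translate g^-1 (translate g s) = s.
Proof. by apply/fsetP => v; rewrite !mem_translate invgK mulKg. Qed.

Lemma translateVK g s : translate g (translate g^-1 s) = s.
Proof. by rewrite -[g in X in translate X]invgK translateK. Qed.

Lemma translate_sub g s F : (translate g s `<=` translate g F) = (s `<=` F).
Proof.
apply/fsubsetP/fsubsetP => H v vs; last by rewrite mem_translate H// -mem_translate.
have := H (g * v)%g; rewrite !mem_translate !mulKg; exact.
Qed.

Lemma weight_push g f F s : weight (translate g F) (push g f) (translate g s) = weight F f s.
Proof.
have pE v : push g f (g * v)%g = f v by rewrite pushE mulKg.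
have DE : translate g F `\` translate g s = translate g (F `\` s).
  by apply/fsetP => v; rewrite !inE !mem_translate !inE.
rewrite /weight /layer /height DE !big_translate.
congr (Num.max 0 (_ - _)); last by apply: eq_bigr => v _; rewrite pE.
by under eq_bigr do rewrite pE; congr bigop; apply: eq_bigr => v _; rewrite pE.
Qed.

Lemma recenter_mass_push g f : recenter_mass (push g f) = push g (recenter_mass f).
Proof.
apply/fsfunP => v; rewrite pushE !(recenter_massE _ (fsubset_refl _)) /recenter_sum finsupp_push.
rewrite (perm_big [seq translate g s | s <- fpowerset (finsupp f)]); last first.
  apply: uniq_perm; rewrite ?fset_uniq//.
    rewrite map_inj_uniq ?fset_uniq// => s t st.
    by rewrite -[s](translateK g) st translateK.
  move=> s; rewrite fpowersetE; apply/idP/mapP => [sf|[t tf ->]].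
    exists (translate g^-1 s); last by rewrite translateVK.
    by rewrite fpowersetE -(translate_sub g) translateVK.
  by rewrite translate_sub -fpowersetE.
rewrite big_map; apply: eq_bigr => s _.
by rewrite weight_push C_equiv mem_translate.
Qed.

Lemma cvg_recenter_mass {T : Type} (FF : set_system T) {_ : Filter FF} (phi : T -> mass) f F :
  finsupp f `<=` F -> (\forall x \near FF, finsupp (phi x) `<=` F) ->
  (forall v, phi x v @[x --> FF] --> f v) ->
  [/\ finsupp (recenter_mass f) `<=` moved F,
     \forall x \near FF, finsupp (recenter_mass (phi x)) `<=` moved F
    & forall v, recenter_mass (phi x) v @[x --> FF] --> recenter_mass f v].
Proof.
have movedS F1 F2 : F1 `<=` F2 -> moved F1 `<=` moved F2.
  move=> F12; apply/fsubsetP => v /bigfcupP[s]; rewrite andbT fpowersetE => sF1 vs.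
  by apply/bigfcupP; exists s => //; rewrite andbT fpowersetE (fsubset_trans sF1).
move=> fF phiF phif; split=> [||v].
- by apply: fsubset_trans (finsupp_recenter_mass f) (movedS _ _ fF).
- by apply: filterS phiF => x xF; apply: fsubset_trans (finsupp_recenter_mass _) (movedS _ _ xF).
rewrite (recenter_massE v fF).
have : recenter_sum F (phi x) v @[x --> FF] --> recenter_sum F f v.
  apply: cvg_bigop => [||s].
  - by move=> *; exact: cvgD.
  - exact: cvg_cst.
  - by apply: cvgM; [exact: cvg_weight|exact: cvg_cst].
apply: cvg_trans; apply: near_eq_cvg.
by apply: filterS phiF => x xF; rewrite (recenter_massE v xF).
Qed.

Definition settled f (n : nat) : Prop := bounded_by d r0 (finsupp (iter n recenter_mass f)).

(** Supports become small after finitely many steps, and from then on the iteration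
    is stationary ([retractE]), so that any such number of steps may be chosen. *)
Definition retract f : mass := iter (xget 0%N (settled f)) recenter_mass f.

Lemma iter_recenter_mass_ge0 n f : nonneg f -> nonneg (iter n recenter_mass f).
Proof. by case: n => //= n _; exact: recenter_mass_ge0. Qed.

Lemma iter_recenter_mass_neq0 n f : nonneg f -> finsupp f != fset0 ->
  finsupp (iter n recenter_mass f) != fset0.
Proof.
move=> f0 fn0; elim: n => //= n; apply: recenter_mass_neq0; exact: iter_recenter_mass_ge0.
Qed.

(** The number of steps depends only on a bound on the diameter of the support; the
    continuity of the retraction rests on this. *)
Lemma settle_uniform (r : R) : exists n, forall f, bounded_by d r (finsupp f) -> settled f n.
Proof.
have H n f : bounded_by d r (finsupp f) ->
    bounded_by d (Num.max r0 ((9 / 10) ^+ n * r)) (finsupp (iter n recenter_mass f)).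
  move=> fb; elim: n => [|n IH] x y /= xf yf.
    by rewrite expr0 mul1r le_max (fb _ _ xf yf) orbT.
  apply: le_trans (recenter_mass_shrinks IH xf yf) _.
  rewrite maxr_pMr; last lra.
  rewrite exprS -mulrA !ge_max !le_max !lexx/= orbT andbT.
  by apply/orP; left; have := r0_gt0; lra.
have : (9 / 10) ^+ n * r @[n --> \oo] --> (0 * r : R).
  by apply: cvgM; [apply: cvg_expr; rewrite ger0_norm; lra|exact: cvg_cst].
rewrite mul0r => /cvgrPdist_le/(_ r0 r0_gt0)[n _ /(_ n (leqnn n))] /= Hn.
exists n => f /H{}H x y xf yf; apply: le_trans (H n x y xf yf) _.
rewrite ge_max lexx/=; apply: le_trans Hn.
by rewrite sub0r normrN ler_norm.
Qed.

Lemma finsupp_bounded f : exists r : R, bounded_by d r (finsupp f).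
Proof.
exists (\big[Num.max/0]_(x <- finsupp f) \big[Num.max/0]_(y <- finsupp f) d x y).
move=> x y xf yf; apply: (@le_trans _ _ (\big[Num.max/0]_(y <- finsupp f) d x y)).
  exact: le_bigmax_seq.
by apply: (le_bigmax_seq _ x xpredT (fun x => \big[Num.max/0]_(y <- finsupp f) d x y)).
Qed.

Lemma settledS f n m : nonneg f -> settled f n -> (n <= m)%N ->
  iter m recenter_mass f = iter n recenter_mass f.
Proof.
move=> f0 fn nm; rewrite -(subnK nm); elim: (m - n)%N => //= k IH.
by rewrite IH recenter_mass_small//; exact: iter_recenter_mass_ge0.
Qed.

Lemma retractE f n : nonneg f -> settled f n -> retract f = iter n recenter_mass f.
Proof.
move=> f0 fn; rewrite /retract; case: xgetP => [m _ fm|/(_ n)//].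
have [nm|/ltnW mn] := leqP n m; first exact: settledS.
by apply/esym; exact: settledS.
Qed.

Lemma retract_settled f : nonneg f -> exists2 n, settled f n & retract f = iter n recenter_mass f.
Proof.
move=> f0; have [r /(proj2_sig (cid (settle_uniform r)))] := finsupp_bounded f.
move=> fn; exists (sval (cid (settle_uniform r))) => //; exact: retractE.
Qed.

Lemma retract_bounded f : nonneg f -> bounded_by d r0 (finsupp (retract f)).
Proof. by move=> /retract_settled[n fn ->]. Qed.

Lemma retract_ge0 f : nonneg f -> nonneg (retract f).
Proof. exact: iter_recenter_mass_ge0. Qed.

Lemma retract_neq0 f : nonneg f -> finsupp f != fset0 -> finsupp (retract f) != fset0.
Proof. exact: iter_recenter_mass_neq0. Qed.

Lemma retract_small f : nonneg f -> bounded_by d r0 (finsupp f) -> retract f = f.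
Proof. by move=> f0 fb; rewrite (@retractE f 0). Qed.

Lemma bounded_push r g f : bounded_by d r (finsupp f) -> bounded_by d r (finsupp (push g f)).
Proof.
move=> fb x y; rewrite finsupp_push !mem_translate => xf yf.
by rewrite -(d_inv g^-1); exact: fb.
Qed.

Lemma retract_push g f : nonneg f -> retract (push g f) = push g (retract f).
Proof.
move=> f0; have [n fn ->] := retract_settled f0.
have iterE m : iter m recenter_mass (push g f) = push g (iter m recenter_mass f).
  by elim: m => //= m ->; rewrite recenter_mass_push.
rewrite -iterE; apply: retractE; first exact: push_ge0.
by rewrite /settled iterE; exact: bounded_push.
Qed.

Lemma cvg_retract {T : Type} (FF : set_system T) {_ : Filter FF} (phi : T -> mass) f F :
  finsupp f `<=` F -> (\forall x \near FF, finsupp (phi x) `<=` F) ->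
  nonneg f -> (\forall x \near FF, nonneg (phi x)) ->
  (forall v, phi x v @[x --> FF] --> f v) ->
  exists F', [/\ finsupp (retract f) `<=` F',
    \forall x \near FF, finsupp (retract (phi x)) `<=` F'
    & forall v, retract (phi x) v @[x --> FF] --> retract f v].
Proof.
move=> fF phiF f0 phi0 phif.
pose r := \big[Num.max/0]_(x <- F) \big[Num.max/0]_(y <- F) d x y.
have [n Hn] := settle_uniform r.
have bdF (h : mass) : finsupp h `<=` F -> bounded_by d r (finsupp h).
  move=> /fsubsetP hF x y /hF xF /hF yF.
  apply: (@le_trans _ _ (\big[Num.max/0]_(y <- F) d x y)); first exact: le_bigmax_seq.
  by apply: (le_bigmax_seq _ x xpredT (fun x => \big[Num.max/0]_(y <- F) d x y)).
have [F' [fF' phiF' phif']] : exists F', [/\ finsupp (iter n recenter_mass f) `<=` F',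
    \forall x \near FF, finsupp (iter n recenter_mass (phi x)) `<=` F'
    & forall v, iter n recenter_mass (phi x) v @[x --> FF] --> iter n recenter_mass f v].
  elim: (n) => [|m [F' [H1 H2 H3]]]; first by exists F.
  by exists (moved F'); apply: cvg_recenter_mass.
have phiE : \forall x \near FF, retract (phi x) = iter n recenter_mass (phi x).
  by near=> x; apply: retractE; [near: x|apply: Hn; apply: bdF; near: x].
exists F'; split=> [||v].
- by rewrite (retractE f0 (Hn _ (bdF _ fF))).
- by move: phiE phiF'; apply: filterS2 => x ->.
- rewrite (retractE f0 (Hn _ (bdF _ fF))).
  apply: cvg_trans (phif' v); apply: near_eq_cvg.
  by apply: filterS phiE => x ->.
Unshelve. all: by end_near.
Qed.

End Recentering.

(** * The Rips complex as a space of probability measures *)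

Section RipsSpace.
Context {R : realType} {G : groupType}.
Variables (d : G -> G -> R) (r : R).
Hypothesis dP : proper_metric d.
Let d_refl := pm_refl dP.
Let d_inv := pm_inv dP.
Let d_fin := pm_fin dP.
Hypothesis r_gt0 : 0 < r.
Local Notation mass := {fsfun G -> R with 0}.
Implicit Types (f : mass) (F s : {fset G}).

Definition total_mass f : R := \sum_(v <- finsupp f) f v.

Definition rips_mass f : Prop :=
  [/\ nonneg f, total_mass f = 1 & bounded_by d r (finsupp f)].

Definition rips_point := {f : mass | `[< rips_mass f >]}.

(** Pointwise convergence is the weak topology of the complex, because the complex
    is locally finite ([rips_locally_finite]). *)
Definition rips : topologicalType :=
  sup_topology (fun v : G =>
    Topological.on (initial_topology (fun e : rips_point => val e v : R))).

Definition mass_of (e : rips) : mass := val (e : rips_point).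

Lemma rips_cvgP (FF : set_system rips) (x : rips) : Filter FF ->
  FF --> x <-> forall v, mass_of e v @[e --> FF] --> mass_of x v.
Proof.
move=> FFF; have cvg_supE := @cvg_sup rips_point G (fun v => Topological.on
  (initial_topology (fun e : rips_point => val e v : R))) FF x FFF; split.
  move=> /cvg_supE FFx v A /(@initial_continuous rips_point R (fun e => val e v) x) H.
  exact: (FFx v _ H).
move=> FFx; apply/cvg_supE => v A /= [_ [[B Bo <-] Bx] sBA].
have nB : nbhs (mass_of x v) B by exact: open_nbhs_nbhs.
exact: (@filterS _ FF _ _ _ sBA (FFx v _ nB)).
Qed.

Lemma mass_of_cvg (x : rips) v : mass_of e v @[e --> x] --> mass_of x v.
Proof. exact: ((@rips_cvgP (nbhs x) x (nbhs_filter x)).1 (@cvg_id _ (nbhs x)) v). Qed.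

Lemma mass_ofP (x : rips) : rips_mass (mass_of x).
Proof. by apply/asboolP; exact: (valP (x : rips_point)). Qed.

Lemma mass_of_inj : injective mass_of.
Proof. by move=> x y /val_inj. Qed.

Definition simplex_mass f : Prop :=
  [/\ nonneg f, finsupp f != fset0 & bounded_by d r (finsupp f)].

Lemma total_mass_gt0 f : nonneg f -> finsupp f != fset0 -> 0 < total_mass f.
Proof.
move=> f0 /fset0Pn[v vf]; rewrite /total_mass (bigD1_seq v) ?fset_uniq//=.
by rewrite ltr_wpDr -?finsupp_gt0// sumr_ge0.
Qed.

Lemma rips_mass_simplex f : rips_mass f -> simplex_mass f.
Proof.
move=> [f0 f1 fb]; split => //; apply/eqP => supp0.
move: f1; rewrite /total_mass supp0 big_seq big_pred0 => [/eqP|v]; last by rewrite inE.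
by rewrite eq_sym oner_eq0.
Qed.

Definition normalize f : mass := [fsfun v in finsupp f => f v / total_mass f | 0].

Lemma normalizeE f v : normalize f v = f v / total_mass f.
Proof. by rewrite fsfunE; case: finsuppP => //; rewrite mul0r. Qed.

Lemma total_mass_sub F f : finsupp f `<=` F -> total_mass f = \sum_(v <- F) f v.
Proof. by move=> fF; apply: big_fset_incl => // v _ /fsfun_dflt. Qed.

Lemma finsupp_normalize f : nonneg f -> finsupp f != fset0 ->
  finsupp (normalize f) = finsupp f.
Proof.
move=> f0 fn; apply/fsetP => v; rewrite !mem_finsupp normalizeE mulf_eq0 invr_eq0.
by rewrite (gt_eqF (total_mass_gt0 f0 fn)) orbF.
Qed.

Lemma normalizeP f : simplex_mass f -> rips_mass (normalize f).
Proof.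
move=> [f0 fn fb]; have t0 := total_mass_gt0 f0 fn; split.
- by move=> v; rewrite normalizeE divr_ge0// ltW.
- rewrite /total_mass finsupp_normalize//; under eq_bigr do rewrite normalizeE.
  by rewrite -mulr_suml divff// gt_eqF.
- by rewrite finsupp_normalize.
Qed.

Lemma dirac_mass : rips_mass [fsfun v in [fset 1%g] => 1 | 0].
Proof.
have E v : [fsfun v in [fset 1%g] => 1 | 0 : R] v = (v == 1%g :> G)%:R.
  by rewrite fsfunE inE; case: eqP.
have S : finsupp [fsfun v in [fset 1%g : G] => 1 | 0 : R] = [fset 1%g].
  by apply/fsetP => v; rewrite mem_finsupp E inE pnatr_eq0 eqb0 negbK.
split.
- by move=> v; rewrite E.
- by rewrite /total_mass S big_seq_fset1 E eqxx.
- by move=> x y; rewrite S !inE => /eqP-> /eqP->; rewrite d_refl ltW.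
Qed.

Definition rips_unit : rips :=
  (exist (fun f : mass => `[< rips_mass f >]) _ (asboolT dirac_mass) : rips_point).

(** Meaningful for a [simplex_mass] only; the Dirac measure is a default value. *)
Definition mk_rips f : rips := insubd (rips_unit : rips_point) (normalize f).

Lemma mass_of_mk f : simplex_mass f -> mass_of (mk_rips f) = normalize f.
Proof.
move=> /normalizeP fP; rewrite /mass_of /mk_rips.
by rewrite (@insubdK _ _ rips_point)//; exact/asboolP.
Qed.

Lemma mk_rips_scale (x : rips) f c : 0 < c ->
  (forall v, f v = c * mass_of x v) -> mk_rips f = x.
Proof.
move=> c0 fE; have [x0 x1 xb] := mass_ofP x.
have [_ xn _] := rips_mass_simplex (mass_ofP x).
have S : finsupp f = finsupp (mass_of x).
  by apply/fsetP => v; rewrite !mem_finsupp fE mulf_eq0 (gt_eqF c0).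
have fs : simplex_mass f.
  by split; rewrite ?S// => v; rewrite fE mulr_ge0// ltW.
apply: mass_of_inj; rewrite mass_of_mk//; apply/fsfunP => v.
rewrite normalizeE /total_mass S; under eq_bigr do rewrite fE.
by rewrite -mulr_sumr -/(total_mass _) x1 mulr1 fE mulrC mulKf// gt_eqF.
Qed.

Lemma mk_ripsK x : mk_rips (mass_of x) = x.
Proof. by apply: (@mk_rips_scale x _ 1) => // v; rewrite mul1r. Qed.

(** The total mass is a continuous function only on a fixed finite support. *)
Lemma cvg_mk_rips {T : Type} (FF : set_system T) {_ : Filter FF} (phi : T -> mass) f F :
  finsupp f `<=` F -> (\forall x \near FF, finsupp (phi x) `<=` F) ->
  simplex_mass f -> (\forall x \near FF, simplex_mass (phi x)) ->
  (forall v, phi x v @[x --> FF] --> f v) ->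
  mk_rips (phi x) @[x --> FF] --> mk_rips f.
Proof.
move=> fF phiF fs phis phif; have [f0 fn fb] := fs; apply/rips_cvgP => v.
rewrite mass_of_mk// normalizeE (total_mass_sub fF).
suff Hv : mass_of (mk_rips (phi x)) v @[x --> FF] --> f v / \sum_(w <- F) f w by exact: Hv.
have : phi x v / (\sum_(w <- F) phi x w) @[x --> FF] --> f v / (\sum_(w <- F) f w).
  apply: cvgM => //; apply: cvgV; first by rewrite -(total_mass_sub fF) gt_eqF// total_mass_gt0.
  by apply: cvg_bigop => //; [move=> *; exact: cvgD|exact: cvg_cst].
apply: cvg_trans; apply: near_eq_cvg.
move: phiF phis; apply: filterS2 => x xF xs.
by rewrite mass_of_mk// normalizeE (total_mass_sub xF).
Qed.

(** If [x] charges [v], then so do all nearby measures, and their supports lie in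
    the ball of radius [r] around [v]. *)
Lemma rips_locally_finite (x : rips) : exists F, finsupp (mass_of x) `<=` F /\
  \forall e \near x, finsupp (mass_of e) `<=` F.
Proof.
have [x0 /fset0Pn[v vx] xb] := rips_mass_simplex (mass_ofP x).
have sub (e : rips) : 0 < mass_of e v ->
    finsupp (mass_of e) `<=` fset_set [set w | d v w <= r].
  have [e0 _ eb] := rips_mass_simplex (mass_ofP e) => ev.
  apply/fsubsetP => w we; apply/in_fset_setP; first exact: d_fin.
  by apply: eb => //; rewrite finsupp_gt0.
exists (fset_set [set w | d v w <= r]); split.
  by apply: sub; rewrite -finsupp_gt0.
have vx0 : 0 < mass_of x v by rewrite -finsupp_gt0.
have : \forall e \near nbhs x, 0 < mass_of e v by exact: (cvgr_gt _ (@mass_of_cvg x v) _ vx0).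
by apply: filterS => e; exact: sub.
Qed.

Lemma rips_hausdorff : hausdorff_space rips.
Proof.
move=> x y xy; apply: mass_of_inj; apply/fsfunP => v.
apply: (@norm_hausdorff R R^o) => A B nA nB.
have [e [eA eB]] := xy _ _ (mass_of_cvg nA) (mass_of_cvg nB).
by exists (mass_of e v).
Qed.

Lemma total_mass_push g f : total_mass (push g f) = total_mass f.
Proof.
rewrite /total_mass finsupp_push big_translate.
by apply: eq_bigr => v _; rewrite pushE mulKg.
Qed.

Definition rips_act (g : G) (x : rips) : rips := mk_rips (push g (mass_of x)).

Lemma push_simplex g f : simplex_mass f -> simplex_mass (push g f).
Proof.
move=> [f0 /fset0Pn[v vf] fb]; split.
- exact: push_ge0.
- by apply/fset0Pn; exists (g * v)%g; rewrite finsupp_push mem_translate mulKg.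
- exact: (bounded_push dP).
Qed.

Lemma normalize_push g f : normalize (push g f) = push g (normalize f).
Proof. by apply/fsfunP => v; rewrite normalizeE !pushE normalizeE total_mass_push. Qed.

Lemma rips_act_mk g f : simplex_mass f -> rips_act g (mk_rips f) = mk_rips (push g f).
Proof.
move=> fs; rewrite /rips_act (mass_of_mk fs); apply: mass_of_inj.
have gs := push_simplex g (rips_mass_simplex (normalizeP fs)).
rewrite (mass_of_mk gs) (mass_of_mk (push_simplex g fs)).
apply/fsfunP => v; rewrite normalizeE total_mass_push normalize_push.
by have [_ -> _] := normalizeP fs; rewrite divr1.
Qed.

Lemma mass_of_act g x : mass_of (rips_act g x) = push g (mass_of x).
Proof.
rewrite mass_of_mk; last exact/push_simplex/rips_mass_simplex/mass_ofP.
apply/fsfunP => v; rewrite normalizeE total_mass_push.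
by have [_ -> _] := mass_ofP x; rewrite divr1.
Qed.

Lemma rips_is_action : is_action rips_act.
Proof.
split=> [x|g h x]; apply: mass_of_inj; rewrite !mass_of_act; first exact: push1.
exact: pushM.
Qed.

Lemma rips_act_continuous g : continuous (rips_act g).
Proof.
move=> x; apply/rips_cvgP => [|v].
  by apply: fmap_filter; exact: nbhs_filter.
suff H : mass_of (rips_act g e) v @[e --> x] --> mass_of (rips_act g x) v by exact: H.
under eq_fun do rewrite mass_of_act pushE.
by rewrite mass_of_act pushE; exact: mass_of_cvg.
Qed.

(** An element fixing a point permutes its finite support, on which the group
    acts freely. *)
Lemma rips_stabilizer_finite x : finite_set (stabilizer rips_act x).
Proof.
have [_ /fset0Pn[v vx] _] := rips_mass_simplex (mass_ofP x).
apply: (sub_finite_set _ (finite_image (fun w => (w * v^-1)%g)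
  (finite_fset (finsupp (mass_of x))))).
move=> g gx; exists (g * v)%g; last by rewrite mulgK.
have := congr1 mass_of gx; rewrite mass_of_act => <- /=.
by rewrite finsupp_push mem_translate mulKg.
Qed.

End RipsSpace.

(** * Contracting the fixed-point sets *)

Section Contraction.
Context {R : realType} {G : groupType}.
Variables (d : G -> G -> R) (r0 : R) (C : {fset G} -> {fset G}).
Hypotheses (dP : proper_metric d) (CP : recentering d r0 C).
Local Notation mass := {fsfun G -> R with 0}.
Local Notation mk := (mk_rips dP (rc_gt0 CP)).
Local Notation act := (rips_act dP (rc_gt0 CP)).
Implicit Types (f g : mass).

(** Absolute values make the interpolation nonnegative for every real [t]. *)
Definition interpolate (t : R) f g : mass :=
  [fsfun v in finsupp f `|` finsupp g => `|1 - t| * f v + `|t| * g v | 0].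

Lemma interpolateE t f g v : interpolate t f g v = `|1 - t| * f v + `|t| * g v.
Proof.
rewrite fsfunE inE; case: ifPn => //; rewrite negb_or => /andP[vf vg].
by rewrite !fsfun_dflt// !mulr0 addr0.
Qed.

Lemma finsupp_interpolate t f g : finsupp (interpolate t f g) `<=` finsupp f `|` finsupp g.
Proof.
apply/fsubsetP => v; rewrite mem_finsupp fsfunE; case: ifP => //.
by rewrite eqxx.
Qed.

Lemma interpolate_ge0 t f g : nonneg f -> nonneg g -> nonneg (interpolate t f g).
Proof.
by move=> f0 g0 v; rewrite interpolateE; apply: addr_ge0; apply: mulr_ge0.
Qed.

Lemma interpolate_neq0 t f g : nonneg f -> nonneg g ->
  finsupp f != fset0 -> finsupp g != fset0 -> finsupp (interpolate t f g) != fset0.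
Proof.
move=> f0 g0 /fset0Pn[v vf] /fset0Pn[w wg]; apply/fset0Pn.
have [t0|t0] := eqVneq t 0; [exists v|exists w]; rewrite finsupp_gt0 ?interpolateE.
- by rewrite t0 subr0 normr1 mul1r normr0 mul0r addr0 -finsupp_gt0.
- exact: interpolate_ge0.
- by rewrite ltr_wpDl// ?mulr_ge0// mulr_gt0 ?normr_gt0// -finsupp_gt0.
- exact: interpolate_ge0.
Qed.

Lemma retract_simplex f : nonneg f -> finsupp f != fset0 ->
  simplex_mass d r0 (retract d r0 C f).
Proof.
move=> f0 fn; split.
- exact: retract_ge0.
- exact: (retract_neq0 CP).
- exact: (retract_bounded dP CP).
Qed.

Section FixedPoints.
Variables (H : {pred G}).
Hypotheses (HG : group_closed H) (Hfin : finite_set [set` H]).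

(** The uniform measure on [H], up to normalization. *)
Definition orbit_mass : mass := [fsfun v in fset_set [set` H] => 1 | 0].

Lemma orbit_massE v : orbit_mass v = (v \in H)%:R.
Proof.
rewrite fsfunE; have -> : (v \in fset_set [set` H]) = (v \in H).
  by rewrite in_fset_set// mem_setE.
by case: (v \in H).
Qed.

Lemma orbit_mass_ge0 : nonneg orbit_mass.
Proof. by move=> v; rewrite orbit_massE. Qed.

Lemma orbit_mass_neq0 : finsupp orbit_mass != fset0.
Proof.
apply/fset0Pn; exists 1%g; rewrite mem_finsupp orbit_massE.
by have [-> _] := HG; rewrite oner_eq0.
Qed.

Lemma push_orbit_mass h : h \in H -> push h orbit_mass = orbit_mass.
Proof.
move=> hH; apply/fsfunP => v; rewrite pushE !orbit_massE; congr (nat_of_bool _)%:R.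
have HM := group_closedM HG; have HV := group_closedV HG.
apply/idP/idP => vH; first by rewrite -(mulVKg h v); apply: HM.
by apply: HM => //; exact: HV.
Qed.

(** The straight line from a measure to the uniform measure on [H], brought back
    into the Rips complex. *)
Definition contraction (p : R * rips d r0) : rips d r0 :=
  mk (retract d r0 C (interpolate p.1 (mass_of p.2) orbit_mass)).

Lemma interpolate_push t h f : h \in H ->
  interpolate t (push h f) orbit_mass = push h (interpolate t f orbit_mass).
Proof.
move=> hH; apply/fsfunP => v; rewrite pushE !interpolateE pushE.
by rewrite -(pushE h orbit_mass) push_orbit_mass.
Qed.

Lemma contraction_fixed t x : fixed_set act H x -> fixed_set act H (contraction (t, x)).
Proof.
move=> xH h hH; rewrite /contraction/=.
have [x0 xn xb] := rips_mass_simplex (mass_ofP x).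
have i0 := interpolate_ge0 t x0 orbit_mass_ge0.
have in0 := interpolate_neq0 t x0 orbit_mass_ge0 xn orbit_mass_neq0.
rewrite rips_act_mk; last exact: retract_simplex.
by rewrite -(retract_push dP CP)// -interpolate_push// -(mass_of_act dP (rc_gt0 CP)) xH.
Qed.

(** Near [x] all supports lie in one finite set, where the retraction is
    continuous. *)
Lemma contraction_continuous : continuous contraction.
Proof.
move=> [t0 x]; have [F [xF nF]] := rips_locally_finite dP x.
have [x0 xn xb] := rips_mass_simplex (mass_ofP x).
have simp (p : R * rips d r0) : nonneg (interpolate p.1 (mass_of p.2) orbit_mass) /\
    finsupp (interpolate p.1 (mass_of p.2) orbit_mass) != fset0.
  have [y0 yn _] := rips_mass_simplex (mass_ofP p.2); split.
    exact: interpolate_ge0 orbit_mass_ge0.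
  exact: interpolate_neq0 orbit_mass_ge0 yn orbit_mass_neq0.
have sub t (y : rips d r0) : finsupp (mass_of y) `<=` F ->
    finsupp (interpolate t (mass_of y) orbit_mass) `<=` F `|` finsupp orbit_mass.
  by move=> yF; apply: fsubset_trans (finsupp_interpolate _ _ _) (fsetSU _ yF).
have near2 : \forall p \near (t0, x), finsupp (mass_of p.2) `<=` F.
  exact: (@cvg_snd _ _ (nbhs t0) (nbhs x) _ _ nF).
have lim v : interpolate p.1 (mass_of p.2) orbit_mass v @[p --> (t0, x)] -->
    interpolate t0 (mass_of x) orbit_mass v.
  under eq_fun do rewrite interpolateE; rewrite interpolateE.
  have c1 : p.1 @[p --> (t0, x)] --> t0 by exact: cvg_fst.
  have c2 : mass_of p.2 v @[p --> (t0, x)] --> mass_of x v.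
    apply: (@cvg_comp _ _ _ snd (fun e : rips d r0 => mass_of e v)); first exact: cvg_snd.
    exact: mass_of_cvg.
  apply: cvgD; apply: cvgM => //; last exact: cvg_cst.
  - by apply: cvg_norm; apply: cvgB => //; exact: cvg_cst.
  - exact: cvg_norm.
have [F' [H1 H2 H3]] := cvg_retract dP CP (sub _ _ xF)
  (filterS (fun p => @sub p.1 p.2) near2) (simp (t0, x)).1
  (filterE _ (fun p => (simp p).1)) lim.
apply: cvg_mk_rips H1 H2 _ _ H3.
  by apply: retract_simplex; have [] := simp (t0, x).
by apply: nearW => p; apply: retract_simplex; have [] := simp p.
Qed.

Lemma fixed_set_contractible : contractible R (fixed_set act H).
Proof.
have H0 := orbit_mass_ge0; have Hn := orbit_mass_neq0.
pose c := mk (retract d r0 C orbit_mass); exists c, contraction; split.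
- move=> h hH; rewrite /c rips_act_mk; last exact: retract_simplex.
  by rewrite -(retract_push dP CP)// push_orbit_mass.
- exact/continuous_subspaceT/contraction_continuous.
- by move=> t x _ xH; exact: contraction_fixed.
- move=> x xH; have [x0 _ xb] := rips_mass_simplex (mass_ofP x).
  rewrite /contraction/=; split.
    have -> : interpolate 0 (mass_of x) orbit_mass = mass_of x.
      by apply/fsfunP => v; rewrite interpolateE subr0 normr1 mul1r normr0 mul0r addr0.
    by rewrite (retract_small CP)// mk_ripsK.
  congr (mk (retract _ _ _ _)).
  by apply/fsfunP => v; rewrite interpolateE subrr normr0 mul0r normr1 mul1r add0r.
Qed.

End FixedPoints.
End Contraction.

(** * Disks and cubes *)

Section Rescaling.
Context {R : realType} {n : nat}.
Variables (N M : 'rV[R]_n -> R).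
Hypotheses (NZ : forall a u, N (a *: u) = `|a| * N u) (MZ : forall a u, M (a *: u) = `|a| * M u).
Hypotheses (N0 : forall u, 0 <= N u) (M0 : forall u, `|u| <= M u).
Hypotheses (Nc : continuous N) (Mc : continuous M).

(** Moves each ray into itself, carrying the balls of [N] to those of [M]. It is
    used for the Euclidean norm and the sup norm, in both directions. *)
Definition rescale (u : 'rV[R]_n) : 'rV[R]_n := (N u / M u) *: u.

Lemma gauge_gt0 u : u != 0 -> 0 < M u.
Proof. by move=> u0; apply: lt_le_trans (M0 u); rewrite normr_gt0. Qed.

Lemma gauge0 : N 0 = 0.
Proof. by rewrite -(scale0r (0 : 'rV[R]_n)) NZ normr0 mul0r. Qed.

Lemma rescale_norm u : M (rescale u) = N u.
Proof.
have [->|u0] := eqVneq u 0.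
  by rewrite /rescale scaler0 gauge0 -(scale0r (0 : 'rV[R]_n)) MZ normr0 mul0r.
have Mu := gauge_gt0 u0.
by rewrite MZ ger0_norm ?divfK ?gt_eqF// divr_ge0// ltW.
Qed.

Lemma rescale_continuous : continuous rescale.
Proof.
move=> u; have [->|u0] := eqVneq u 0; last first.
  have Mu : M u != 0 by rewrite gt_eqF// gauge_gt0.
  have HN : N x @[x --> u] --> N u by exact: Nc.
  have HM : (M x)^-1 @[x --> u] --> (M u)^-1 by exact: (cvgV Mu (Mc (x := u))).
  exact: (cvgZ (cvgM HN HM) (@cvg_id _ (nbhs u))).
(* At the origin [M (rescale v) = N v] tends to [0], and [M] dominates the norm. *)
rewrite /continuous_at {2}/rescale scaler0; apply/cvgr0Pnorm_lt => [|e e0].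
  exact: (@nbhs_filter 'rV[R]_n 0).
have : \forall v \near nbhs (0 : 'rV[R]_n), N v < e.
  by apply: (cvgr_lt (N 0)); [exact: Nc|rewrite gauge0].
by apply: filterS => v Nv; apply: le_lt_trans (M0 _) _; rewrite rescale_norm.
Qed.

End Rescaling.

Lemma rescaleK {R : realType} {n : nat} (N M : 'rV[R]_n -> R) :
  (forall a u, N (a *: u) = `|a| * N u) -> (forall a u, M (a *: u) = `|a| * M u) ->
  (forall u, `|u| <= M u) -> (forall u, u != 0 -> 0 < N u) ->
  cancel (rescale N M) (rescale M N).
Proof.
move=> NZ MZ M0 N0 u; have [->|u0] := eqVneq u 0; first by rewrite /rescale !scaler0.
have Mu := gauge_gt0 M0 u0; have Nu := N0 u u0.
rewrite {1}/rescale rescale_norm//; last first.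
  by move=> v; have [->|/N0/ltW//] := eqVneq v 0; rewrite -(scale0r (0 : 'rV[R]_n)) NZ normr0 mul0r.
rewrite /rescale NZ scalerA ger0_norm; last by rewrite divr_ge0// ltW.
by rewrite -[RHS]scale1r; congr (_ *: _); field; rewrite !gt_eqF.
Qed.

Section DiskCube.
Context {R : realType} {n : nat}.
Local Notation V := 'rV[R]_n.

Lemma coord_le_norm (u : V) i : `|u ord0 i| <= `|u|.
Proof.
rewrite /Num.Def.normr/= mx_normrE.
exact: (@le_bigmax _ _ _ 0 (fun i : 'I_1 * 'I_n => `|u i.1 i.2|) (ord0, i)).
Qed.

Lemma norm_attained (u : V) : `|u| != 0 -> exists i, `|u| = `|u ord0 i|.
Proof.
move=> u0; have [[i j]/= E] := mx_norm_neq0 u0.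
by exists j; rewrite (ord1 i) in E; exact: E.
Qed.

Lemma norm_le_euclid (u : V) : `|u| <= euclid_norm u.
Proof.
have [->|u0] := eqVneq `|u| 0; first exact: sqrtr_ge0.
have [i ->] := norm_attained u0; rewrite -sqrtr_sqr ler_wsqrtr// (bigD1 i)//=.
by rewrite lerDl sumr_ge0// => j _; exact: sqr_ge0.
Qed.

Lemma euclid_norm_continuous : continuous (@euclid_norm R n).
Proof.
move=> u; rewrite /euclid_norm.
apply: (@cvg_comp _ _ _ (fun u : V => \sum_(i < n) u ord0 i ^+ 2) Num.sqrt);
  last exact: sqrt_continuous.
apply: (@cvg_bigop R _ (nbhs u) (nbhs_filter u)) => [f g b c||i]; try exact: cvg_cst.
  by move=> *; exact: cvgD.
apply: (@cvg_comp _ _ _ (fun u : V => u ord0 i) (fun x : R => x ^+ 2)).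
  exact: coord_continuous.
exact: exprn_continuous.
Qed.

Definition disk_to_cube : V -> V := rescale (@euclid_norm R n) (fun u => `|u|).
Definition cube_to_disk : V -> V := rescale (fun u => `|u|) (@euclid_norm R n).

Lemma euclid_norm_gt0 (u : V) : u != 0 -> 0 < euclid_norm u.
Proof. by move=> u0; apply: lt_le_trans (norm_le_euclid u); rewrite normr_gt0. Qed.

Lemma disk_to_cube_norm u : `|disk_to_cube u| = euclid_norm u.
Proof.
apply: (@rescale_norm _ _ (@euclid_norm R n) (fun u => `|u|)) => //.
- exact: euclid_normZ.
- by move=> a v; exact: normrZ.
- by move=> v; exact: sqrtr_ge0.
Qed.

Lemma cube_to_disk_norm u : euclid_norm (cube_to_disk u) = `|u|.
Proof.
apply: (@rescale_norm _ _ (fun u => `|u|) (@euclid_norm R n)) => //.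
- by move=> a v; exact: normrZ.
- exact: euclid_normZ.
- exact: norm_le_euclid.
Qed.

Lemma disk_to_cube_continuous : continuous disk_to_cube.
Proof.
apply: rescale_continuous => //.
- exact: euclid_normZ.
- by move=> a v; exact: normrZ.
- by move=> v; exact: sqrtr_ge0.
- exact: euclid_norm_continuous.
- exact: norm_continuous.
Qed.

Lemma cube_to_disk_continuous : continuous cube_to_disk.
Proof.
apply: rescale_continuous => //.
- by move=> a v; exact: normrZ.
- exact: euclid_normZ.
- exact: norm_le_euclid.
- exact: norm_continuous.
- exact: euclid_norm_continuous.
Qed.

Lemma disk_to_cubeK : cancel disk_to_cube cube_to_disk.
Proof.
apply: rescaleK => //.
- exact: euclid_normZ.
- by move=> a v; exact: normrZ.
- exact: euclid_norm_gt0.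
Qed.

Lemma cube_to_diskK : cancel cube_to_disk disk_to_cube.
Proof.
apply: rescaleK => //.
- by move=> a v; exact: normrZ.
- exact: euclid_normZ.
- exact: norm_le_euclid.
- by move=> u; rewrite normr_gt0.
Qed.

Lemma closed_disk_compact : compact (@closed_disk R n).
Proof.
apply: bounded_closed_compact.
  exists 1; split; first exact: num_real.
  move=> x x1 u /= u1; apply: le_trans (norm_le_euclid u) _.
  exact: le_trans u1 (ltW x1).
rewrite (_ : closed_disk n = @euclid_norm R n @^-1` [set x | x <= 1]); last by [].
apply: closed_comp; last exact: closed_le.
by move=> u _; exact: euclid_norm_continuous.
Qed.

End DiskCube.

(** * Rankings *)

Section Rankings.
Context {R : realType} {G : groupType}.
Local Notation mass := {fsfun G -> R with 0}.
Local Notation ranking := {fsfun G -> nat with 0%N}.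
Implicit Types (f : mass) (l : ranking) (F : {fset G}).

Definition gapless l : Prop :=
  forall v j, (0 < j <= l v)%N -> exists w, l w = j.

(** The superlevel sets of a gapless [l] form a chain of simplices, that is, a simplex
    of the barycentric subdivision; its open simplex consists of the [f] ranked
    by [l]. *)
Definition ranked_by f l : Prop :=
  (forall v, (f v == 0) = (l v == 0%N)) /\ (forall v w, (f v < f w) = (l v < l w)%N).

(** By induction on the rank: a point of rank [j.+2] has a point of rank [j.+1] below
    it, and this is visible in the values of [f]. *)
Lemma ranked_le f l l' v : gapless l -> ranked_by f l -> ranked_by f l' -> (l v <= l' v)%N.
Proof.
move=> lg [lz lo] [lz' lo'].
have [m] := ubnP (l v); elim: m v => // m IH v.
case E : (l v) => [//|[|j]] jm.
  by rewrite lt0n -lz' lz E.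
have [w lw] : exists w, l w = j.+1 by apply: (lg v); rewrite E leqnSn.
have := IH w; rewrite lw => /(_ jm) /leq_ltn_trans; apply.
by rewrite -lo' lo lw E.
Qed.

Lemma ranked_unique f l l' : gapless l -> gapless l' ->
  ranked_by f l -> ranked_by f l' -> l = l'.
Proof.
move=> lg lg' fl fl'; apply/fsfunP => v; apply/eqP.
by rewrite eqn_leq (ranked_le v lg fl fl') (ranked_le v lg' fl' fl).
Qed.

Lemma ranked_finsupp f l : ranked_by f l -> finsupp l = finsupp f.
Proof. by move=> [lz _]; apply/fsetP => v; rewrite !mem_finsupp lz. Qed.

Lemma ranked_eq f l v w : ranked_by f l -> l v = l w -> f v = f w.
Proof.
move=> [_ lo] vw; apply/eqP; rewrite eq_le !leNgt !lo vw.
by rewrite ltnn.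
Qed.

Section RankOf.
Variables (f : mass).
Hypothesis f0 : nonneg f.

Definition values_below (x : R) : {fset R} := [fset y in [fset f w | w in finsupp f] | y <= x].

Definition rank_of : ranking := [fsfun v in finsupp f => #|` values_below (f v)| | 0%N].

Lemma mem_values_below x y :
  reflect (exists2 w, w \in finsupp f & y = f w /\ y <= x) (y \in values_below x).
Proof.
apply: (iffP idP) => [|[w wf [-> yx]]]; rewrite !inE/=.
  by move=> /andP[/imfsetP[w /= wf ->] yx]; exists w.
by rewrite yx andbT; apply/imfsetP; exists w.
Qed.

Lemma rank_ofE v : rank_of v = #|` values_below (f v)|.
Proof.
rewrite fsfunE; case: ifPn => // vf; rewrite fsfun_dflt//.
apply/esym/eqP; rewrite cardfs_eq0; apply/fset0Pn => -[y /mem_values_below[w wf [-> w0]]].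
by move: wf; rewrite finsupp_gt0// ltNge w0.
Qed.

Lemma rank_of_le v w : f v <= f w -> (rank_of v <= rank_of w)%N.
Proof.
move=> vw; rewrite !rank_ofE; apply: fsubset_leq_card; apply/fsubsetP => y.
move=> /mem_values_below[u uf [-> uv]]; apply/mem_values_below.
by exists u => //; split => //; exact: le_trans vw.
Qed.

Lemma rank_of_lt v w : f v < f w -> (rank_of v < rank_of w)%N.
Proof.
move=> vw; rewrite !rank_ofE; apply: fproper_ltn_card; rewrite fproperE; apply/andP; split.
  apply/fsubsetP => y /mem_values_below[u uf [-> uv]]; apply/mem_values_below.
  by exists u => //; split => //; exact: le_trans (ltW vw).
apply/fsubsetPn; exists (f w).
  by apply/mem_values_below; exists w => //; rewrite finsupp_gt0// (le_lt_trans (f0 v)).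
by apply/mem_values_below => -[u _ [_]]; rewrite leNgt vw.
Qed.

Lemma rank_of_ranked : ranked_by f rank_of.
Proof.
split=> [v|v w].
  apply/idP/idP => [/eqP fv|].
    by rewrite fsfunE mem_finsupp fv eqxx.
  apply: contraTT => fv; rewrite rank_ofE cardfs_eq0; apply/fset0Pn; exists (f v).
  by apply/mem_values_below; exists v; rewrite ?mem_finsupp.
apply/idP/idP; first exact: rank_of_lt.
by apply: contraTT; rewrite -leNgt -leqNgt; exact: rank_of_le.
Qed.

(** The point sought carries the largest of the values smaller than [f v]. *)
Lemma rank_of_pred v m : rank_of v = m.+2 -> exists w, rank_of w = m.+1.
Proof.
move=> vm; pose S := [fset y in values_below (f v) | y < f v].
have SE : values_below (f v) = f v |` S.
  apply/fsetP => y; rewrite !inE/=; have [->|yv] := eqVneq y (f v).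
    have vf : v \in finsupp f by rewrite mem_finsupp rank_of_ranked.1 vm.
    by rewrite lexx andbT; apply/imfsetP; exists v.
  by rewrite lt_neqAle yv /=; case: (y <= f v); rewrite ?andbF ?andbT.
have Sm : #|` S| = m.+1.
  have := rank_ofE v; rewrite vm SE cardfsU1.
  by rewrite !inE/= ltxx andbF/= => -[].
have inS z : (z \in S) = (z \in values_below (f v)) && (z < f v) by rewrite !inE.
have [y0 y0S] : exists y0, y0 \in S by apply/fset0Pn; rewrite -cardfs_eq0 Sm.
have [y yS ymin] := seq_argmin (fun y => - y) y0S.
have : y \in values_below (f v) by move: yS; rewrite inS => /andP[].
move=> /mem_values_below[w wf [yw _]]; exists w; rewrite rank_ofE -yw -Sm.
congr #|` _|; apply/fsetP => z; apply/idP/idP => [/mem_values_below[u uf [-> uy]]|zS].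
  have yv : y < f v by move: yS; rewrite inS => /andP[].
  rewrite inS (le_lt_trans uy yv) andbT; apply/mem_values_below; exists u => //; split => //.
  exact: le_trans uy (ltW yv).
have : z \in values_below (f v) by move: (zS); rewrite inS => /andP[].
move=> /mem_values_below[u uf [zu _]]; apply/mem_values_below; exists u => //; split => //.
by rewrite -lerN2 ymin.
Qed.

Lemma rank_of_gapless : gapless rank_of.
Proof.
move=> v j; have [n] := ubnP (rank_of v); elim: n v => // n IH v vn /andP[j0].
rewrite leq_eqVlt => /predU1P[->|jv]; first by exists v.
case E : (rank_of v) vn jv => [|[|m]] vn jv //; first by move: jv; rewrite ltnS leqNgt j0.
have [w wm] := rank_of_pred E; apply: (IH w); rewrite wm; first exact: vn.
by rewrite j0 -ltnS.
Qed.

End RankOf.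

Lemma nat_max_attained (T : eqType) (g : T -> nat) (s : seq T) x0 : x0 \in s ->
  exists2 x, x \in s & (\max_(y <- s) g y)%N = g x.
Proof.
elim: s x0 => // y s IH x0 _; rewrite big_cons.
have [->|[z zs]] : s = [::] \/ exists z, z \in s.
- by case: s {IH} => [|z s]; [left|right; exists z; rewrite inE eqxx].
- by exists y; rewrite ?inE// big_nil maxn0.
have [x xs ->] := IH z zs.
have [yx|xy] := leqP (g y) (g x).
- by exists x; rewrite ?inE ?xs ?orbT//; apply/maxn_idPr.
- by exists y; rewrite ?inE ?eqxx//; apply/maxn_idPl/ltnW.
Qed.

Definition levels l : nat := (\max_(v <- finsupp l) l v)%N.

Lemma levels_ge l v : (l v <= levels l)%N.
Proof.
have [vl|vl] := boolP (v \in finsupp l); last by rewrite fsfun_dflt.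
exact: leq_bigmax_seq.
Qed.

Lemma levels_rep l j : gapless l -> (0 < j <= levels l)%N -> exists w, l w = j.
Proof.
move=> lg /andP[j0]; rewrite /levels.
have [->|/fset0Pn[v vl]] := eqVneq (finsupp l) fset0.
  rewrite big_seq big_pred0 => [|v]; last by rewrite inE.
  by case: j j0.
have [x _ ->] := nat_max_attained l vl => jx.
by apply: (lg x); rewrite j0.
Qed.

Lemma levels_gt0 l : finsupp l != fset0 -> (0 < levels l)%N.
Proof.
move=> /fset0Pn[v vl]; apply: leq_trans (levels_ge l v).
by rewrite lt0n -mem_finsupp.
Qed.

Lemma levels_le_card l : gapless l -> (levels l <= #|` finsupp l|)%N.
Proof.
move=> lg; rewrite -[levels l](size_iota 1) -(size_map l).
apply: uniq_leq_size; first exact: iota_uniq.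
move=> j; rewrite mem_iota add1n ltnS => jl; have [w lw] := levels_rep lg jl.
apply/mapP; exists w => //; rewrite mem_finsupp lw.
by case/andP: jl; rewrite lt0n.
Qed.

Lemma bounded_rankings_finite F (N : nat) :
  finite_set [set l : ranking | finsupp l `<=` F /\ forall v, (l v <= N)%N].
Proof.
pose Phi (a : {ffun F -> 'I_N.+1}) : ranking := [fsfun v : F => nat_of_ord (a v) | 0%N].
apply: (sub_finite_set _ (finite_image Phi (@finite_finset _ setT))) => l [lF lN].
exists [ffun v : F => inord (l (val v))] => //; apply/fsfunP => v.
rewrite fsfun_ffun; case: insubP => [u uF uv|vF]/=.
  by rewrite ffunE inordK ?uv// ltnS.
by rewrite fsfun_dflt//; apply: contra vF; exact: (fsubsetP lF).
Qed.

Lemma gapless_rankings_finite F :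
  finite_set [set l : ranking | gapless l /\ finsupp l `<=` F].
Proof.
apply: sub_finite_set (bounded_rankings_finite F #|` F|) => l [lg lF]; split=> // v.
apply: leq_trans (levels_ge l v) _; apply: leq_trans (levels_le_card lg) _.
exact: fsubset_leq_card.
Qed.

Lemma ranked_push g f l : ranked_by f l -> ranked_by (push g f) (push g l).
Proof. by move=> [lz lo]; split=> [v|v w]; rewrite !pushE. Qed.

Lemma gapless_push g l : gapless l -> gapless (push g l).
Proof.
move=> lg v j; rewrite pushE => /lg[w lw].
by exists (g * w)%g; rewrite pushE mulKg.
Qed.

End Rankings.

(** * Cells *)

Section LevelValues.
Context {R : realType} {k : nat}.
Implicit Types (y : 'I_k -> R).

(** The value at level [j], normalized to be [1] at the top level [k.+1], if
    [y i] is the ratio of the values at the levels [i.+1] and [i.+2]. In these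
    coordinates the simplex of increasing values is a cube. *)
Definition level_value y (j : nat) : R := \prod_(i < k | (j <= i.+1)%N) y i.

Lemma level_value_step y (i : 'I_k) : level_value y i.+1 = y i * level_value y i.+2.
Proof.
rewrite /level_value (bigD1 i)//=; congr (_ * _); apply: eq_bigl => j.
by rewrite !ltnS ltn_neqAle andbC eq_sym.
Qed.

Lemma level_value_top y j : (k < j)%N -> level_value y j = 1.
Proof.
move=> kj; rewrite /level_value big_pred0// => i.
by apply/negbTE; rewrite -ltnNge (leq_ltn_trans _ kj).
Qed.

Lemma level_value_ge0 y j : (forall i, 0 <= y i) -> 0 <= level_value y j.
Proof. by move=> y0; apply: prodr_ge0. Qed.

Lemma level_value_gt0 y j : (forall i, 0 < y i) -> 0 < level_value y j.
Proof. by move=> y0; apply: prodr_gt0. Qed.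

Lemma level_value_le y j j' : (forall i, 0 <= y i <= 1) -> (0 < j <= j')%N ->
  level_value y j <= level_value y j'.
Proof.
move=> y01 /andP[j0 jj']; rewrite -(subnK jj').
elim: (j' - j)%N => //= n IH; apply: le_trans IH _; rewrite addSn.
have [kn|nk] := ltnP k (n + j); first by rewrite !level_value_top// ltnS ltnW.
have [m E] : exists m, (n + j)%N = m.+1 by exists (n + j).-1; rewrite prednK// addn_gt0 j0 orbT.
rewrite E in nk *; rewrite (level_value_step y (Ordinal nk)) /=.
have [y0 y1] := andP (y01 (Ordinal nk)).
by rewrite ler_piMl// level_value_ge0// => i; have /andP[] := y01 i.
Qed.

Lemma level_value_lt y j j' : (forall i, 0 < y i < 1) -> (0 < j < j')%N -> (j <= k)%N ->
  level_value y j < level_value y j'.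
Proof.
move=> y01 /andP[j0 jj'] jk; apply: (@lt_le_trans _ _ (level_value y j.+1)); last first.
  by apply: level_value_le => // i; have /andP[/ltW-> /ltW->] := y01 i.
case: j j0 jj' jk => // j _ _ jk; rewrite (level_value_step y (Ordinal jk)) /=.
have [y0 y1] := andP (y01 (Ordinal jk)).
by rewrite gtr_pMl// level_value_gt0// => i; have /andP[] := y01 i.
Qed.

Lemma cvg_level_value {T : Type} (FF : set_system T) {_ : Filter FF}
    (phi : T -> 'I_k -> R) y j :
  (forall i, phi x i @[x --> FF] --> y i) ->
  level_value (phi x) j @[x --> FF] --> level_value y j.
Proof.
move=> phiy; rewrite /level_value [X in _ --> X]big_mkcond.
under eq_fun do rewrite big_mkcond.
apply: cvg_bigop => [f g b c||i]; [by move=> *; exact: cvgM|exact: cvg_cst|].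
by case: ifP => // _; exact: cvg_cst.
Qed.

End LevelValues.

Section Cells.
Context {R : realType} {G : groupType}.
Variables (d : G -> G -> R) (r : R).
Hypotheses (dP : proper_metric d) (r_gt0 : 0 < r).
Local Notation mass := {fsfun G -> R with 0}.
Local Notation ranking := {fsfun G -> nat with 0%N}.
Local Notation mk := (mk_rips dP r_gt0).
Local Notation act := (rips_act dP r_gt0).
Implicit Types (f : mass) (l : ranking) (F : {fset G}).

Definition rank_cell l : Prop :=
  [/\ finsupp l != fset0, bounded_by d r (finsupp l) & gapless l].

Definition rank_mass l (y : 'I_(levels l).-1 -> R) : mass :=
  [fsfun v in finsupp l => level_value y (l v) | 0].

(** The coordinate [w] of the cube [[-1, 1]^n] goes to [(1 + w) / 2]. The absolute
    value keeps it nonnegative outside the disk, so that [rank_char] is continuous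
    everywhere. *)
Definition cube_coords n (u : 'rV[R]_n) (i : 'I_n) : R :=
  `|1 + disk_to_cube u ord0 i| / 2.

Definition rank_char l (u : 'rV[R]_(levels l).-1) : rips d r :=
  mk (rank_mass (cube_coords u)).

Lemma rank_massE l y v : rank_mass (l := l) y v = if l v == 0%N then 0 else level_value y (l v).
Proof. by rewrite fsfunE mem_finsupp; case: eqP. Qed.

Lemma finsupp_rank_mass l y : finsupp (rank_mass (l := l) y) `<=` finsupp l.
Proof.
apply/fsubsetP => v; rewrite !mem_finsupp rank_massE; case: ifP => //.
by rewrite eqxx.
Qed.

Section OneCell.
Variable (l : ranking).
Hypothesis lP : rank_cell l.
Local Notation k := (levels l).-1.
Implicit Types (y : 'I_k -> R).

Lemma levelsE : levels l = k.+1.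
Proof. by case: lP => ln _ _; rewrite prednK// levels_gt0. Qed.

Lemma rank_mass_simplex y : (forall i, 0 <= y i) -> simplex_mass d r (rank_mass y).
Proof.
move=> y0; have [ln lb lg] := lP; split.
- by move=> v; rewrite rank_massE; case: ifP => // _; exact: level_value_ge0.
- have [v lv] : exists v, l v = levels l.
    by apply: (levels_rep lg); rewrite levels_gt0//=.
  have kv : (k < l v)%N by rewrite lv levelsE.
  apply/fset0Pn; exists v; rewrite mem_finsupp rank_massE level_value_top//.
  by case: ifP => [/eqP lv0|]; [rewrite lv0 in kv|rewrite oner_eq0].
- move=> a b /(fsubsetP (finsupp_rank_mass y)) al /(fsubsetP (finsupp_rank_mass y)) bl.
  exact: lb.
Qed.

Lemma rank_le_dim v : (l v <= k.+1)%N.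
Proof. by rewrite -levelsE levels_ge. Qed.

Lemma rank_mass_le y v w : (forall i, 0 <= y i <= 1) -> (l v <= l w)%N ->
  rank_mass y v <= rank_mass y w.
Proof.
move=> y01 vw; rewrite !rank_massE; have y0 i : 0 <= y i by have /andP[] := y01 i.
case: eqP => [v0|/eqP v0]; case: eqP => [w0|/eqP w0] //.
- exact: level_value_ge0.
- by move: vw; rewrite w0 leqn0 (negbTE v0).
- by apply: level_value_le => //; rewrite lt0n v0.
Qed.

Lemma rank_mass_ranked y : (forall i, 0 < y i < 1) -> ranked_by (rank_mass y) l.
Proof.
move=> y01; have y0 i : 0 < y i by have /andP[] := y01 i.
split=> [v|v w].
  by rewrite rank_massE; case: (l v =P 0%N) => _; rewrite ?eqxx// (gt_eqF (level_value_gt0 _ y0)).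
apply/idP/idP => [|vw].
  apply: contraTT; rewrite -leNgt -leqNgt; apply: rank_mass_le => i.
  by have /andP[/ltW-> /ltW->] := y01 i.
rewrite !rank_massE; have w0 : l w != 0%N by rewrite -lt0n (leq_ltn_trans _ vw).
rewrite (negbTE w0); case: eqP => [_|/eqP v0]; first exact: level_value_gt0.
apply: level_value_lt => //; first by rewrite lt0n v0.
by rewrite -ltnS (leq_trans vw)// rank_le_dim.
Qed.

Lemma normalize_ranked f l' : simplex_mass d r f -> ranked_by f l' ->
  ranked_by (normalize f) l'.
Proof.
move=> [f0 fn _] [lz lo]; have t0 := total_mass_gt0 f0 fn.
split=> [v|v w]; rewrite !normalizeE.
- by rewrite mulf_eq0 invr_eq0 (gt_eqF t0) orbF.
- by rewrite ltr_pM2r ?invr_gt0.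
Qed.

Definition level_rep (j : nat) : G := xget 1%g [set w | l w = j].

Lemma level_repP j : (0 < j <= k.+1)%N -> l (level_rep j) = j.
Proof.
move=> jk; have [_ _ lg] := lP.
have [w lw] : exists w, l w = j by apply: (levels_rep lg); rewrite levelsE.
rewrite /level_rep; case: xgetP => [w' _ //|/(_ w)//].
Qed.

Definition level_ratio f (i : 'I_k) : R := f (level_rep i.+1) / f (level_rep i.+2).

Lemma level_bounds (i : 'I_k) : (0 < i.+1 <= k.+1)%N /\ (0 < i.+2 <= k.+1)%N.
Proof. by split; rewrite /= ltnS // ltnW. Qed.

Lemma level_ratio_range f i : nonneg f -> ranked_by f l -> 0 < level_ratio f i < 1.
Proof.
move=> f0 [lz lo]; have [b1 b2] := level_bounds i.
have p1 : 0 < f (level_rep i.+1) by rewrite lt_neqAle f0 andbT eq_sym lz level_repP.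
have p2 : 0 < f (level_rep i.+2) by rewrite lt_neqAle f0 andbT eq_sym lz level_repP.
by rewrite /level_ratio divr_gt0// ltr_pdivrMr// mul1r lo !level_repP/=.
Qed.

(** A measure with ranking [l] is determined, up to scaling, by the ratios of
    its consecutive values. *)
Lemma rank_mass_ratio f : nonneg f -> ranked_by f l ->
  0 < f (level_rep k.+1) /\
  forall v, rank_mass (level_ratio f) v = (f (level_rep k.+1))^-1 * f v.
Proof.
move=> f0 fl; have [lz lo] := fl.
have pos j : (0 < j <= k.+1)%N -> 0 < f (level_rep j).
  move=> jk; rewrite lt_neqAle f0 andbT eq_sym lz level_repP//.
  by case/andP: jk; rewrite lt0n.
split=> [|v]; first by apply: pos; rewrite leqnn.
have topgt := pos k.+1 ltac:(by rewrite leqnn).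
(* Descending induction on the level, multiplying the ratios. *)
have key n : (n <= k)%N -> level_value (level_ratio f) (k.+1 - n) =
    (f (level_rep k.+1))^-1 * f (level_rep (k.+1 - n)).
  elim: n => [|n IH] nk.
    by rewrite subn0 level_value_top// mulVf// gt_eqF.
  have ki : (k - n.+1 < k)%N by rewrite ltn_subrL (leq_trans _ nk).
  have E1 : (k.+1 - n.+1 = (k - n.+1).+1)%N by rewrite subSn.
  have E2 : (k.+1 - n = (k - n.+1).+2)%N by rewrite -subSn// subSS subSn// ltnW.
  have := IH (ltnW nk); rewrite E1 E2 => IH'.
  rewrite (level_value_step _ (Ordinal ki)) IH' /level_ratio /=.
  have p2 := pos _ (level_bounds (Ordinal ki)).2.
  by field; rewrite !gt_eqF.
rewrite rank_massE; case: (l v =P 0%N) => [lv|/eqP lv].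
  by have := lz v; rewrite lv eqxx => /eqP ->; rewrite mulr0.
have lvk : (0 < l v <= k.+1)%N by rewrite lt0n lv rank_le_dim.
have := key (k.+1 - l v)%N; rewrite subKn; last exact: rank_le_dim.
rewrite leq_subLR -addn1 addnC leq_add2r lt0n => /(_ lv) ->.
by congr (_ * _); apply: (ranked_eq fl); rewrite level_repP.
Qed.

Lemma cube_coords_ge0 n (u : 'rV[R]_n) i : 0 <= cube_coords u i.
Proof. by rewrite /cube_coords divr_ge0. Qed.

Lemma cube_coords_open n (u : 'rV[R]_n) i : open_disk n u -> 0 < cube_coords u i < 1.
Proof.
move=> u1; have : `|disk_to_cube u ord0 i| < 1.
  by apply: le_lt_trans (coord_le_norm _ _) _; rewrite disk_to_cube_norm.
rewrite ltr_norml => /andP[H1 H2]; rewrite /cube_coords ger0_norm; last lra.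
by apply/andP; split; lra.
Qed.

Lemma cube_coords_closed n (u : 'rV[R]_n) i : euclid_norm u <= 1 -> 0 <= cube_coords u i <= 1.
Proof.
move=> u1; have : `|disk_to_cube u ord0 i| <= 1.
  by apply: le_trans (coord_le_norm _ _) _; rewrite disk_to_cube_norm.
rewrite ler_norml => /andP[H1 H2]; rewrite /cube_coords ger0_norm; last lra.
by apply/andP; split; lra.
Qed.

Lemma cube_coords_sphere n (u : 'rV[R]_n) : euclid_norm u = 1 ->
  exists i, cube_coords u i = 0 \/ cube_coords u i = 1.
Proof.
move=> u1; have N1 : `|disk_to_cube u| = 1 by rewrite disk_to_cube_norm.
have [i] := norm_attained (ltac:(by rewrite N1 oner_eq0) : `|disk_to_cube u| != 0).
rewrite N1 => Ni; exists i; rewrite /cube_coords.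
have [H|H] := leP 0 (disk_to_cube u ord0 i).
  by right; rewrite ger0_norm// in Ni; rewrite -Ni ger0_norm; lra.
by left; rewrite ltr0_norm// in Ni; rewrite (_ : 1 + _ = 0) ?normr0 ?mul0r//; lra.
Qed.

Definition cube_point n (y : 'I_n -> R) : 'rV[R]_n := cube_to_disk (\row_i (2 * y i - 1)).

Lemma cube_pointK n (y : 'I_n -> R) : (forall i, 0 <= y i) -> cube_coords (cube_point y) =1 y.
Proof.
move=> y0 i; rewrite /cube_coords cube_to_diskK mxE.
by rewrite (_ : 1 + _ = 2 * y i); [rewrite ger0_norm; [field|rewrite mulr_ge0]|lra].
Qed.

Lemma cube_coordsK n (u : 'rV[R]_n) : open_disk n u -> cube_point (cube_coords u) = u.
Proof.
move=> u1; rewrite -[RHS]disk_to_cubeK /cube_point; congr cube_to_disk.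
apply/rowP => i; rewrite mxE /cube_coords.
have : `|disk_to_cube u ord0 i| < 1.
  by apply: le_lt_trans (coord_le_norm _ _) _; rewrite disk_to_cube_norm.
by rewrite ltr_norml => /andP[H1 H2]; rewrite ger0_norm; lra.
Qed.

Lemma cube_point_open n (y : 'I_n -> R) : (forall i, 0 < y i < 1) -> open_disk n (cube_point y).
Proof.
move=> y01; rewrite /open_disk/= cube_to_disk_norm.
have [->|w0] := eqVneq `|\row_i (2 * y i - 1)| 0; first exact: ltr01.
have [i ->] := norm_attained w0; rewrite mxE ltr_norml.
by have /andP[H1 H2] := y01 i; apply/andP; split; lra.
Qed.

Lemma rank_char_ranked u : open_disk k u -> ranked_by (mass_of (rank_char u)) l.
Proof.
move=> u1; have s : simplex_mass d r (rank_mass (cube_coords u)).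
  by apply: rank_mass_simplex => i; exact: cube_coords_ge0.
rewrite /rank_char mass_of_mk//; apply: normalize_ranked => //.
by apply: rank_mass_ranked => i; exact: cube_coords_open.
Qed.

Lemma rank_char_onto (e : rips d r) : ranked_by (mass_of e) l ->
  open_disk k (cube_point (level_ratio (mass_of e))) /\
  rank_char (cube_point (level_ratio (mass_of e))) = e.
Proof.
move=> el; have [e0 e1 eb] := mass_ofP e.
have y01 i : 0 < level_ratio (mass_of e) i < 1 by exact: level_ratio_range.
split; first exact: cube_point_open.
have [top ratio] := rank_mass_ratio e0 el.
apply: (@mk_rips_scale _ _ _ _ dP r_gt0 e _ (mass_of e (level_rep k.+1))^-1).
  by rewrite invr_gt0.
move=> v; rewrite -ratio !rank_massE; case: eqP => // _.
rewrite /level_value; apply: eq_bigr => i _; apply: cube_pointK => j.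
by have /andP[/ltW] := y01 j.
Qed.

Lemma level_ratio_normalize f i : simplex_mass d r f ->
  level_ratio (normalize f) i = level_ratio f i.
Proof.
move=> [f0 fn _]; rewrite /level_ratio !normalizeE.
have t0 := total_mass_gt0 f0 fn.
by rewrite -mulf_div divff ?mulr1// invr_eq0 gt_eqF.
Qed.

Lemma level_ratio_mass y i : (forall j, 0 < y j) -> level_ratio (rank_mass y) i = y i.
Proof.
move=> y0; have [b1 b2] := level_bounds i.
rewrite /level_ratio !rank_massE !level_repP//= level_value_step.
by rewrite mulfK// gt_eqF// level_value_gt0.
Qed.

Lemma rank_charK u : open_disk k u ->
  cube_point (level_ratio (mass_of (rank_char u))) = u.
Proof.
move=> u1; rewrite -[RHS]cube_coordsK//; congr cube_to_disk; apply/rowP => i.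
rewrite !mxE; congr (2 * _ - 1).
rewrite /rank_char mass_of_mk; last by apply: rank_mass_simplex => j; exact: cube_coords_ge0.
rewrite level_ratio_normalize; last by apply: rank_mass_simplex => j; exact: cube_coords_ge0.
by apply: level_ratio_mass => j; have /andP[] := cube_coords_open j u1.
Qed.

End OneCell.
End Cells.

(** * The equivariant cell structure *)

Lemma cvg_row {R : realType} {T : Type} {n : nat} (FF : set_system T) {_ : Filter FF}
    (phi : T -> 'I_n -> R) (y : 'I_n -> R) :
  (forall i, phi x i @[x --> FF] --> y i) ->
  (\row_i phi x i) @[x --> FF] --> (\row_i y i : 'rV[R]_n).
Proof.
move=> phiy A [P nP PA].
have : \forall x \near FF, forall ij : 'I_1 * 'I_n, P ij.1 ij.2 (phi x ij.2).
  apply: filter_forall => -[i j] /=; apply: phiy.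
  by have := nP i j; rewrite mxE.
by apply: filterS => x Px; apply: PA => i j; rewrite mxE; exact: (Px (i, j)).
Qed.

Section RipsCW.
Context {R : realType} {G : groupType}.
Variables (d : G -> G -> R) (r : R).
Hypotheses (dP : proper_metric d) (r_gt0 : 0 < r).
Local Notation mass := {fsfun G -> R with 0}.
Local Notation ranking := {fsfun G -> nat with 0%N}.
Local Notation mk := (mk_rips dP r_gt0).
Local Notation act := (rips_act dP r_gt0).
Local Notation E := (rips d r).
Implicit Types (f : mass) (l : ranking) (F : {fset G}).

Definition cell_index := {l : ranking | `[< rank_cell d r l >]}.

Definition index_of l (lP : rank_cell d r l) : cell_index :=
  exist (fun l : ranking => `[< rank_cell d r l >]) l (asboolT lP).

Lemma cell_indexP (a : cell_index) : rank_cell d r (val a).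
Proof. exact/asboolP/(valP a). Qed.

Definition rips_cells : CW_structure R E :=
  CWStructure (fun a : cell_index => @rank_char R G d r dP r_gt0 (val a)).

Lemma open_cellP (a : cell_index) (e : E) :
  open_cell (S := rips_cells) a e <-> ranked_by (mass_of e) (val a).
Proof.
have aP := cell_indexP a; split=> [[u u1 <-]|ea]; first exact: rank_char_ranked.
by have [op <-] := rank_char_onto dP r_gt0 aP ea;
   exists (cube_point (level_ratio (l := val a) (mass_of e))).
Qed.

Lemma cell_of (e : E) : exists a : cell_index, ranked_by (mass_of e) (val a).
Proof.
have [e0 en eb] := rips_mass_simplex (mass_ofP e); have re := rank_of_ranked e0.
have P : rank_cell d r (rank_of (mass_of e)).
  rewrite /rank_cell (ranked_finsupp re); split => //.
  exact: rank_of_gapless.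
by exists (index_of P).
Qed.

Lemma cell_unique (e : E) (a b : cell_index) :
  ranked_by (mass_of e) (val a) -> ranked_by (mass_of e) (val b) -> a = b.
Proof.
move=> ea eb; apply: val_inj.
have [_ _ ga] := cell_indexP a; have [_ _ gb] := cell_indexP b.
exact: ranked_unique ga gb ea eb.
Qed.

Lemma cells_finite F : finite_set [set a : cell_index | finsupp (val a) `<=` F].
Proof.
have fin := @gapless_rankings_finite G F.
apply: (@sub_finite_set _ _ (val @^-1` [set l : ranking | gapless l /\ finsupp l `<=` F])).
  by move=> a aF; split => //; have [] := cell_indexP a.
apply: finite_preimage fin => a b _ _; exact: val_inj.
Qed.

Lemma cube_coords_continuous n i : continuous (fun u : 'rV[R]_n => cube_coords u i).
Proof.
move=> u; have H : disk_to_cube v ord0 i @[v --> u] --> disk_to_cube u ord0 i.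
  apply: (@cvg_comp _ _ _ disk_to_cube (fun w : 'rV[R]_n => w ord0 i)).
    exact: disk_to_cube_continuous.
  exact: coord_continuous.
have H1 : `|1 + disk_to_cube v ord0 i| @[v --> u] --> `|1 + disk_to_cube u ord0 i|.
  apply: (@cvg_norm _ _ _ _ (nbhs_filter u)).
  exact: (@cvgD _ _ _ (nbhs u) (nbhs_filter u) _ _ _ _ (@cvg_cst _ _ _ _ (nbhs_filter u)) H).
exact: (@cvgM _ _ (nbhs u) (nbhs_filter u) _ _ _ _ H1 (@cvg_cst _ _ _ _ (nbhs_filter u))).
Qed.

Lemma rank_char_continuous (a : cell_index) :
  continuous (@rank_char R G d r dP r_gt0 (val a)).
Proof.
move=> u; have aP := cell_indexP a.
apply: (@cvg_mk_rips R G d r dP r_gt0 _ (nbhs u) (nbhs_filter u) _ _ (finsupp (val a))).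
- exact: finsupp_rank_mass.
- by apply: (@nearW _ (nbhs u)) => v; exact: finsupp_rank_mass.
- by apply: (rank_mass_simplex aP) => i; exact: cube_coords_ge0.
- by apply: (@nearW _ (nbhs u)) => v; apply: (rank_mass_simplex aP) => i; exact: cube_coords_ge0.
move=> v; rewrite rank_massE (_ : (fun x => rank_mass (cube_coords x) v) = fun x =>
  if val a v == 0%N then 0 else level_value (cube_coords x) (val a v)); last first.
  by apply/funext => x; rewrite rank_massE.
case: ifP => _; first exact: (@cvg_cst _ _ _ _ (nbhs_filter u)).
apply: (@cvg_level_value _ _ _ (nbhs u) (nbhs_filter u)) => i.
exact: cube_coords_continuous.
Qed.

(** The denominators of the ratios are positive on the cell. *)
Lemma chart_continuous (a : cell_index) (e : E) : ranked_by (mass_of e) (val a) ->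
  {for e, continuous (fun e : E => cube_point (level_ratio (l := val a) (mass_of e)))}.
Proof.
move=> ea; have aP := cell_indexP a; have [e0 _ _] := mass_ofP e.
apply: (@cvg_comp _ _ _ (fun e : E => \row_i (2 * level_ratio (l := val a) (mass_of e) i - 1))
  cube_to_disk); last exact: cube_to_disk_continuous.
apply: (@cvg_row R _ _ (nbhs e) (nbhs_filter e)) => i; apply: cvgB; last exact: cvg_cst.
apply: cvgM; first exact: cvg_cst.
apply: cvgM; first exact: mass_of_cvg.
apply: cvgV; last exact: mass_of_cvg.
have [_ b2] := level_bounds i.
by rewrite ea.1 (level_repP aP).
Qed.

(** On the boundary of the cube two consecutive values coincide or a value vanishes,
    so a level is lost. In detail: if [b] had at least as many levels as [a], points
    of [b]-rank [1], ..., [k.+1] would have increasing positive values, hence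
    [a]-rank [1], ..., [k.+1], and every ratio would lie strictly between [0] and
    [1]. *)
Lemma sphere_levels (a b : cell_index) (u : 'rV[R]_(levels (val a)).-1) :
  euclid_norm u = 1 -> ranked_by (mass_of (rank_char dP r_gt0 u)) (val b) ->
  finsupp (val b) `<=` finsupp (val a) /\ (levels (val b) < levels (val a))%N.
Proof.
move=> u1 eb; have aP := cell_indexP a; have bP := cell_indexP b.
have y01 i := cube_coords_closed i (ltac:(by rewrite u1) : euclid_norm u <= 1).
have y0 i := cube_coords_ge0 u i.
have s := rank_mass_simplex aP y0.
set f := rank_mass (cube_coords u) in s.
have fb : ranked_by f (val b).
  move: eb; rewrite /rank_char mass_of_mk// -/f => -[nz no].
  have [f0 fn _] := s; have t0 := total_mass_gt0 f0 fn; split=> [v|v w].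
    by rewrite -nz normalizeE mulf_eq0 invr_eq0 (gt_eqF t0) orbF.
  by rewrite -no !normalizeE ltr_pM2r ?invr_gt0.
split.
  by rewrite (ranked_finsupp fb); exact: finsupp_rank_mass.
rewrite ltnNge; apply/negP => ab; have [fz fo] := fb.
have [_ _ gb] := bP; pose k := (levels (val a)).-1.
have Lk : levels (val a) = k.+1 := levelsE aP.
have kL : (k < levels (val b))%N by rewrite -Lk.
have repb j : (0 < j <= k.+1)%N -> val b (level_rep (val b) j) = j.
  move=> /andP[j0 jk]; apply: (level_repP bP).
  by rewrite j0 -(levelsE bP) (leq_trans jk).
have mono v w : f v < f w -> (val a v < val a w)%N.
  by rewrite ltNge; apply: contraR; rewrite -leqNgt; exact: rank_mass_le.
have step j : (0 < j <= k)%N -> f (level_rep (val b) j) < f (level_rep (val b) j.+1).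
  by move=> /andP[j0 jk]; rewrite fo !repb ?j0 ?ltnS ?jk// (leq_trans jk).
have lower j : (j <= k)%N -> (j < val a (level_rep (val b) j.+1))%N.
  elim: j => [_|j IH jk].
    have : f (level_rep (val b) 1) != 0 by rewrite fz repb.
    by rewrite /f rank_massE; case: ifP => [_|/negbT]; rewrite ?eqxx// lt0n.
  by apply: leq_ltn_trans (IH (ltnW jk)) (mono _ _ (step _ _)).
have upper n : (n <= k)%N -> (val a (level_rep (val b) (k.+1 - n)) <= k.+1 - n)%N.
  elim: n => [_|n IH nk]; first by rewrite subn0; exact: (rank_le_dim aP).
  rewrite -ltnS; have E1 : (k.+1 - n = (k.+1 - n.+1).+1)%N by rewrite subnSK// ltnW.
  rewrite -E1; apply: leq_trans (IH (ltnW nk)).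
  apply: mono; rewrite [in X in _ < X]E1; apply: step.
  by rewrite subSS subn_gt0 nk leq_subr.
have exact_level j : (0 < j <= k.+1)%N -> val a (level_rep (val b) j) = j.
  move=> /andP[j0 jk]; apply/eqP; rewrite eqn_leq; apply/andP; split.
    have := upper (k.+1 - j)%N; rewrite subKn//; apply.
    by rewrite leq_subLR -addn1 addnC leq_add2r.
  by case: j j0 jk => // j _; exact: lower.
have valE j : (0 < j <= k.+1)%N ->
    f (level_rep (val b) j) = level_value (cube_coords u) j.
  move=> jk; rewrite /f rank_massE exact_level//.
  by case/andP: jk => j0 _; rewrite eqn0Ngt j0.
have [i yi] := cube_coords_sphere u1.
have [b1 b2] := level_bounds i.
have lt : level_value (cube_coords u) i.+1 < level_value (cube_coords u) i.+2.
  rewrite -!valE//; apply: step; rewrite /=; exact: ltn_ord.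
have pos : level_value (cube_coords u) i.+1 != 0 by rewrite -valE// fz repb.
move: lt pos; rewrite level_value_step.
by case: yi => ->; rewrite ?mul0r ?eqxx// mul1r ltxx.
Qed.

Lemma rips_is_CW : is_CW_complex rips_cells.
Proof.
split.
- exact: rips_hausdorff.
- split.
    apply/trivIsetP => a b _ _ ab; rewrite -subset0 => e [/open_cellP ea /open_cellP eb].
    by case/eqP: ab; exact: cell_unique ea eb.
  apply/seteqP; split=> // e _; have [a ea] := cell_of e.
  by exists a => //; apply/open_cellP.
- move=> a; split; first exact/continuous_subspaceT/rank_char_continuous.
  exists (fun e : E => cube_point (level_ratio (l := val a) (mass_of e))).
    apply: continuous_in_subspaceT => e /set_mem/open_cellP.
    exact: chart_continuous.
  by move=> u u1; apply: rank_charK => //; exact: cell_indexP.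
- move=> a; exists [set b : cell_index | finsupp (val b) `<=` finsupp (val a) /\
      (levels (val b) < levels (val a))%N].
    split; first by apply: sub_finite_set (cells_finite (finsupp (val a))) => b [].
    move=> b [_ ba]; rewrite /= -ltnS -(levelsE (cell_indexP a)).
    by rewrite prednK// levels_gt0//; have [] := cell_indexP b.
  move=> _ [u u1 <-]; have [b eb] := cell_of (rank_char dP r_gt0 u).
  by exists b; [exact: sphere_levels u1 eb|apply/open_cellP].
- move=> A clA x clx; have [F [xF nF]] := rips_locally_finite dP x.
  (* Near [x] the set [A] is covered by finitely many closures of cells. *)
  pose Z := (\bigcup_(a in [set a : cell_index | (finsupp (val a) `<=` F)%fset])
    (A `&` closure (open_cell (S := rips_cells) a)))%classic.
  have clZ : closed Z by apply: closed_bigcup => [|a _]; [exact: cells_finite|exact: clA].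
  suff : Z x by case=> a _ [].
  apply: clZ => U nU; have [e [Ae [Ue eF]]] := clx _ (filterI nU nF).
  have [a ea] := cell_of e; exists e; split => //; exists a.
    by rewrite /= (ranked_finsupp ea).
  by split => //; apply: subset_closure; apply/open_cellP.
Qed.

Lemma push_cell_index g (a : cell_index) : rank_cell d r (push g (val a)).
Proof.
have [/fset0Pn[v vl] lb lg] := cell_indexP a; split.
- by apply/fset0Pn; exists (g * v)%g; rewrite finsupp_push mem_translate mulKg.
- move=> x y; rewrite finsupp_push !mem_translate => xl yl.
  by rewrite -(pm_inv dP g^-1); exact: lb.
- exact: gapless_push.
Qed.

(** An element carrying a point of a cell into the cell preserves its ranking, hence
    the level sets of every measure in the cell, hence these measures. *)
Lemma rips_GCW : is_GCW_complex rips_cells act.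
Proof.
have [act1 actM] := rips_is_action dP r_gt0.
split.
- exact: rips_is_CW.
- by split; [exact: rips_is_action|exact: rips_act_continuous].
- move=> g a; exists (index_of (push_cell_index g a)).
  apply/seteqP; split=> [_ [e /open_cellP ea <-]|e /open_cellP ea].
    by apply/open_cellP; rewrite mass_of_act /=; exact: ranked_push.
  exists (act g^-1%g e); last by rewrite -actM mulgV act1.
  apply/open_cellP; rewrite mass_of_act -[val a](pushK g).
  exact: ranked_push.
- move=> g a [_ [[e /open_cellP ea <-] /open_cellP gea]] x /open_cellP xa.
  have gaE : push g (val a) = val a.
    have [_ _ ga] := cell_indexP a.
    apply: (@ranked_unique R G (mass_of (act g e))) => //.
      exact: gapless_push.
    by rewrite mass_of_act; exact: ranked_push.
  apply: mass_of_inj; rewrite mass_of_act; apply/fsfunP => v.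
  by rewrite pushE; apply: (ranked_eq xa); rewrite -[in RHS]gaE pushE.
Qed.

(** Translate a point of the support to the identity: the support then lies in the
    ball of radius [r] around it, which carries finitely many cells. *)
Lemma rips_cocompact : cocompact_action act.
Proof.
pose F := fset_set [set h | d 1%g h <= r].
exists (\bigcup_(a in [set a : cell_index | (finsupp (val a) `<=` F)%fset])
  (@rank_char R G d r dP r_gt0 (val a) @` closed_disk _))%classic.
  rewrite -(bigsetU_fset_set _ (cells_finite F)); apply: bigsetU_compact => a _.
  apply: continuous_compact; last exact: closed_disk_compact.
  exact/continuous_subspaceT/rank_char_continuous.
apply/seteqP; split=> // e _; have [act1 actM] := rips_is_action dP r_gt0.
have [e0 /fset0Pn[v ve] eb] := rips_mass_simplex (mass_ofP e).
exists v => //; exists (act v^-1%g e); last by rewrite -actM mulgV act1.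
have [a ea] := cell_of (act v^-1%g e); exists a.
  rewrite /= (ranked_finsupp ea) mass_of_act finsupp_push; apply/fsubsetP => w.
  rewrite mem_translate invgK => we; apply/in_fset_setP; first exact: pm_fin.
  by rewrite /= -(pm_inv dP v) mulg1; apply: eb.
have /open_cellP[u u1 ue] := ea; exists u => //.
exact: ltW.
Qed.

End RipsCW.

Theorem theorem1p1 (R : realType) (G : groupType)
  (hG : asymptotically_CAT0_group R G) :
  exists (E : topologicalType) (S : CW_structure R E) (act : G -> E -> E),
    universal_proper_space S act /\ finite_GCW_complex S act.
Proof.
have [d dC] := coarsely_CAT0_of_group hG.
have dP := coarsely_CAT0_proper dC.
have [r [C CP]] := coarsely_CAT0_recentering dC.
exists (rips d r), (rips_cells dP (rc_gt0 CP)), (rips_act dP (rc_gt0 CP)).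
have GCW := rips_GCW dP (rc_gt0 CP).
split; split => //.
- exact: rips_stabilizer_finite.
- by move=> H HG Hfin; exact: fixed_set_contractible.
- exact: rips_cocompact.
Qed.
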